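(* Let $f(z)=z+\sum_{n=2}^\infty a_nz^n\in\mathcal{S}^*_{car}$ and let $f_2(z)=z+a_2z^2$ be its second partial sum. Then $f_2$ is starlike in $|z|<1/2$ and convex in $|z|<1/4$, and $f_2(\rho z)/\rho\in\mathcal{S}^*_{car}$ for $0<\rho\le1/3$. All three constants $1/2$, $1/4$, $1/3$ are sharp (they cannot be replaced by larger numbers).
   Context: $\mathbb{D}=\{z:|z|<1\}$; $\mathcal{A}$ is the class of analytic $f$ on $\mathbb{D}$ with $f(0)=0$, $f'(0)=1$. $F\prec G$ means $F=G\circ w$ for an analytic $w:\mathbb{D}\to\mathbb{D}$ with $w(0)=0$. $\mathcal{S}^*_{car}$ is the class of $f\in\mathcal{A}$ with $zf'(z)/f(z)\prec 1+z+z^2/2$ in $\mathbb{D}$. A function is starlike (resp. convex) in $|z|<r$ if it maps that disk univalently onto a domain starlike with respect to $0$ (resp. convex). *)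

(* Defs.v *)
From Stdlib Require Import Reals.
From Coquelicot Require Import Coquelicot.

Open Scope R_scope.

Definition disk (r : R) (z : C) : Prop := Cmod z < r.
Definition unit_disk : C -> Prop := disk 1.

Definition cderiv (f : C -> C) (z l : C) : Prop :=
  @is_derive C_AbsRing C_NormedModule f z l.
Definition analytic_on (D : C -> Prop) (f : C -> C) : Prop :=
  forall z, D z -> exists l, cderiv f z l.

Definition classA (f : C -> C) : Prop :=
  analytic_on unit_disk f /\ f 0%C = 0%C /\ cderiv f 0%C 1%C.

Definition subordinate (F G : C -> C) : Prop :=
  exists w : C -> C,
    analytic_on unit_disk w /\
    (forall z, unit_disk z -> unit_disk (w z)) /\
    w 0%C = 0%C /\
    (forall z, unit_disk z -> F z = G (w z)).

Definition phi_car (z : C) : C := (1 + z + z * z / 2)%C.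

(* z f'(z)/f(z), extended by its limit value 1 at z = 0 *)
Definition zfpf (f f' : C -> C) (z : C) : C :=
  if Req_EM_T (Cmod z) 0 then 1%C else (z * f' z / f z)%C.

(* S*_car: f in A, z f'/f analytic in D (so f has no zeros in D \ {0}),
   and z f'/f ≺ 1 + z + z^2/2 *)
Definition S_car (f : C -> C) : Prop :=
  classA f /\
  exists f' : C -> C,
    (forall z, unit_disk z -> cderiv f z (f' z)) /\
    (forall z, unit_disk z -> z <> 0%C -> f z <> 0%C) /\
    subordinate (zfpf f f') phi_car.

Definition starlike_in (f : C -> C) (r : R) : Prop :=
  (forall z1 z2, disk r z1 -> disk r z2 -> f z1 = f z2 -> z1 = z2) /\
  (forall z t, disk r z -> 0 <= t <= 1 ->
     exists z', disk r z' /\ f z' = (RtoC t * f z)%C).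

Definition convex_in (f : C -> C) (r : R) : Prop :=
  (forall z1 z2, disk r z1 -> disk r z2 -> f z1 = f z2 -> z1 = z2) /\
  (forall z1 z2 t, disk r z1 -> disk r z2 -> 0 <= t <= 1 ->
     exists z', disk r z' /\
       f z' = (RtoC (1 - t) * f z1 + RtoC t * f z2)%C).

Definition taylor_coeffs (f : C -> C) (a : nat -> C) : Prop :=
  forall z, unit_disk z -> @is_pseries C_AbsRing C_NormedModule a z (f z).

Definition partial2 (a : nat -> C) (z : C) : C := (z + a 2%nat * (z * z))%C.

(* Main.v *)
Require Import Defs.
From Stdlib Require Import Reals Lra Lia IndefiniteDescription FunctionalExtensionality.
From Coquelicot Require Import Coquelicot.

Open Scope R_scope.

(* Writing f = z g, the relation z f'/f = 1 + z g'/g = phi(w) gives a_2 = w'(0), so |a_2| <= 1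
   by the Schwarz lemma. What remains is a study of z + b z^2 with |b| <= 1: completing the
   square, starlikeness and convexity become statements about the image of a disc centred at 1
   under squaring, and membership in S*_car holds for |b| <= 1/3 because
   |phi(w) - 1| = |b z/(1 + b z)| < 1/2 can be solved for w by a square root.
   Sharpness is read off from f(z) = z exp(z + z^2/4), for which a_2 = 1. *)

(** * Complex differentiation via slopes *)

(** Schwarz's lemma is obtained by real calculus: for w with continuous derivative, differentiation
    under the integral shows that the mean of w(z)/z over a circle about 0 is independent of the
    radius. Subordination only provides a w that is complex differentiable at each point; the
    continuity of w' is recovered from the Taylor series of f, because phi'(w) = 1 + w has no zero
    in the disc, so that w' = F'/(1 + w) with F = z f'/f. Starlikeness and convexity speak of
    images, so each asks for a preimage inside the disc. It is produced as a square root with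
    nonnegative real part, and the work lies in bounding its distance from 1. The three constants
    are visible for b = 1 and z negative: z + z^2 has its critical point at -1/2; 1 + z f_2''/f_2' =
    (1 + 4z)/(1 + 2z) vanishes at -1/4; z f_2'/f_2 = (1 + 2z)/(1 + z) takes the boundary value
    phi(-1) = 1/2 at -1/3. *)

Definition ccont (f : C -> C) (z : C) : Prop :=
  forall eps, 0 < eps -> exists d, 0 < d /\
    forall y, Cmod (y - z) < d -> Cmod (f y - f z) < eps.

Lemma Cmod_sub_self (z : C) : Cmod (z - z) = 0.
Proof. replace (z - z)%C with (RtoC 0) by ring. apply Cmod_0. Qed.

Lemma Cmod_sub_sym (y z : C) : Cmod (y - z) = Cmod (z - y).
Proof. rewrite <- Cmod_opp. f_equal. ring. Qed.

Lemma Cmod_sub_eq0 (y z : C) : Cmod (y - z) = 0 -> y = z.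
Proof.
  intros H. apply Cmod_eq_0 in H.
  replace y with ((y - z) + z)%C by ring. rewrite H. ring.
Qed.

Lemma Cmod_le_sub (y z : C) : Cmod y <= Cmod z + Cmod (y - z).
Proof.
  replace y with (z + (y - z))%C at 1 by ring. apply Cmod_triangle.
Qed.

Lemma ccont_const (c z : C) : ccont (fun _ => c) z.
Proof.
  intros e He. exists 1. split; [lra|]. intros y _. rewrite Cmod_sub_self. exact He.
Qed.

Lemma ccont_id (z : C) : ccont (fun y => y) z.
Proof. intros e He. exists e. split; auto. Qed.

Lemma ccont_plus (f g : C -> C) (z : C) :
  ccont f z -> ccont g z -> ccont (fun y => (f y + g y)%C) z.
Proof.
  intros Hf Hg e He.
  destruct (Hf (e/2)) as [d1 [D1 H1]]; [lra|].
  destruct (Hg (e/2)) as [d2 [D2 H2]]; [lra|].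
  exists (Rmin d1 d2). split. { now apply Rmin_glb_lt. }
  intros y Hy.
  assert (A := H1 y (Rlt_le_trans _ _ _ Hy (Rmin_l _ _))).
  assert (B := H2 y (Rlt_le_trans _ _ _ Hy (Rmin_r _ _))).
  replace (f y + g y - (f z + g z))%C with ((f y - f z) + (g y - g z))%C by ring.
  eapply Rle_lt_trans; [apply Cmod_triangle|lra].
Qed.

Lemma ccont_mult (f g : C -> C) (z : C) :
  ccont f z -> ccont g z -> ccont (fun y => (f y * g y)%C) z.
Proof.
  intros Hf Hg e He.
  assert (Pf := Cmod_ge_0 (f z)). assert (Pg := Cmod_ge_0 (g z)).
  set (e1 := e / (2 * (Cmod (g z) + 1))).
  set (e2 := e / (2 * (Cmod (f z) + 1))).
  assert (E1 : 0 < e1) by (apply Rdiv_lt_0_compat; lra).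
  assert (E2 : 0 < e2) by (apply Rdiv_lt_0_compat; lra).
  destruct (Hf e1 E1) as [d1 [D1 H1]].
  destruct (Hg (Rmin 1 e2)) as [d2 [D2 H2]]; [apply Rmin_glb_lt; lra|].
  exists (Rmin d1 d2). split. { now apply Rmin_glb_lt. }
  intros y Hy.
  assert (A := H1 y (Rlt_le_trans _ _ _ Hy (Rmin_l _ _))).
  assert (B := H2 y (Rlt_le_trans _ _ _ Hy (Rmin_r _ _))).
  assert (B1 := Rlt_le_trans _ _ _ B (Rmin_l _ _)).
  assert (B2 := Rlt_le_trans _ _ _ B (Rmin_r _ _)).
  replace (f y * g y - f z * g z)%C
    with ((f y - f z) * g y + f z * (g y - g z))%C by ring.
  eapply Rle_lt_trans; [apply Cmod_triangle|].
  rewrite !Cmod_mult.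
  assert (G := Cmod_le_sub (g y) (g z)).
  assert (K1 : Cmod (f y - f z) * Cmod (g y) <= e1 * (Cmod (g z) + 1)).
  { apply Rmult_le_compat; try apply Cmod_ge_0; lra. }
  assert (K2 : Cmod (f z) * Cmod (g y - g z) <= Cmod (f z) * e2)
    by (apply Rmult_le_compat_l; lra).
  assert (F1 : e1 * (Cmod (g z) + 1) = e / 2) by (unfold e1; field; lra).
  assert (F2 : (Cmod (f z) + 1) * e2 = e / 2) by (unfold e2; field; lra).
  lra.
Qed.

Lemma ccont_inv (f : C -> C) (z : C) :
  f z <> 0%C -> ccont f z -> ccont (fun y => (/ f y)%C) z.
Proof.
  intros Hz Hf e He.
  assert (P := proj1 (Cmod_gt_0 _) Hz).
  set (m := Cmod (f z)) in *.
  assert (E1 : 0 < e * (m * m / 2)) by (apply Rmult_lt_0_compat; nra).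
  destruct (Hf (Rmin (m / 2) (e * (m * m / 2)))) as [d [D H]].
  { apply Rmin_glb_lt; lra. }
  exists d. split; [exact D|]. intros y Hy.
  assert (A := H y Hy).
  assert (A1 := Rlt_le_trans _ _ _ A (Rmin_l _ _)).
  assert (A2 := Rlt_le_trans _ _ _ A (Rmin_r _ _)).
  assert (Q : m / 2 < Cmod (f y)).
  { assert (T := Cmod_le_sub (f z) (f y)). rewrite Cmod_sub_sym in T.
    fold m in T. lra. }
  assert (Hy0 : f y <> 0%C) by (apply Cmod_gt_0; lra).
  replace (/ f y - / f z)%C with (- ((f y - f z) / (f y * f z)))%C
    by (field; auto).
  rewrite Cmod_opp, Cmod_div by (now apply Cmult_neq_0).
  rewrite Cmod_mult. fold m.
  apply Rlt_div_l; [apply Rmult_lt_0_compat; lra|].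
  eapply Rlt_le_trans; [exact A2|]. apply Rmult_le_compat_l; [lra|].
  nra.
Qed.

Lemma ccont_comp (f g : C -> C) (z : C) :
  ccont f z -> ccont g (f z) -> ccont (fun y => g (f y)) z.
Proof.
  intros Hf Hg e He.
  destruct (Hg e He) as [d1 [D1 H1]]. destruct (Hf d1 D1) as [d [D H]].
  exists d. auto.
Qed.

Lemma ccont_ext (f g : C -> C) (z : C) (r : R) :
  0 < r -> (forall y, Cmod (y - z) < r -> f y = g y) -> ccont f z -> ccont g z.
Proof.
  intros Hr E Hf e He. destruct (Hf e He) as [d [D H]].
  exists (Rmin r d). split; [now apply Rmin_glb_lt|]. intros y Hy.
  rewrite <- !E.
  - apply H. eapply Rlt_le_trans; [exact Hy|apply Rmin_r].
  - rewrite Cmod_sub_self. exact Hr.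
  - eapply Rlt_le_trans; [exact Hy|apply Rmin_l].
Qed.

Lemma cderiv_eps (f : C -> C) (z l : C) :
  cderiv f z l <->
  (forall eps, 0 < eps -> exists d, 0 < d /\ forall y, Cmod (y - z) < d ->
     Cmod (f y - f z - (y - z) * l) <= eps * Cmod (y - z)).
Proof.
  split.
  - intros [_ H] e He.
    destruct (H z (fun P Q => Q) (mkposreal e He)) as [d Hd].
    exists d. split; [apply cond_pos|]. intros y Hy. exact (Hd y Hy).
  - intros H. split; [apply is_linear_scal_l|].
    intros x Hx e. apply (@is_filter_lim_locally_unique C_AbsRing (AbsRing_NormedModule C_AbsRing)) in Hx. subst x.
    destruct (H e (cond_pos e)) as [d [D Hd]].
    exists (mkposreal d D). intros y Hy. exact (Hd y Hy).
Qed.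

(** Carathéodory's form of the derivative. The slope [q] is a total function, continuous at [z], so
    the sum, product and chain rules become algebraic identities between slopes, with no estimates
    left. *)
Lemma cderiv_slope (f : C -> C) (z l : C) :
  cderiv f z l <->
  (exists q : C -> C, (forall y, f y = (f z + (y - z) * q y)%C) /\ q z = l /\ ccont q z).
Proof.
  rewrite cderiv_eps. split.
  - intros H.
    set (q := fun y => if Req_EM_T (Cmod (y - z)) 0 then l else ((f y - f z) / (y - z))%C).
    assert (Qz : q z = l).
    { unfold q. destruct (Req_EM_T _ _) as [_|N]; [reflexivity|].
      now destruct N; apply Cmod_sub_self. }
    exists q. split; [|split; [exact Qz|]].
    + intros y. unfold q. destruct (Req_EM_T _ _) as [E|N].
      * apply Cmod_sub_eq0 in E. subst y. ring.
      * field. intros E. apply N. rewrite E. apply Cmod_0.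
    + intros e He. destruct (H (e/2)) as [d [D Hd]]; [lra|].
      exists d. split; [exact D|]. intros y Hy. rewrite Qz. unfold q.
      destruct (Req_EM_T _ _) as [E|N]; [now rewrite Cmod_sub_self|].
      assert (NZ : (y - z)%C <> 0%C) by (intros E; apply N; rewrite E; apply Cmod_0).
      assert (P := proj1 (Cmod_gt_0 _) NZ).
      replace ((f y - f z) / (y - z) - l)%C
        with ((f y - f z - (y - z) * l) / (y - z))%C by (field; exact NZ).
      rewrite Cmod_div by exact NZ.
      apply Rlt_div_l; [exact P|].
      eapply Rle_lt_trans; [now apply Hd|]. nra.
  - intros [q [E [Ql Qc]]] e He. destruct (Qc e He) as [d [D Hd]].
    exists d. split; [exact D|]. intros y Hy. rewrite (E y).
    replace (f z + (y - z) * q y - f z - (y - z) * l)%C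
      with ((q y - l) * (y - z))%C by ring.
    rewrite Cmod_mult. apply Rmult_le_compat_r; [apply Cmod_ge_0|].
    left. rewrite <- Ql. now apply Hd.
Qed.

Lemma cderiv_ccont (f : C -> C) (z l : C) : cderiv f z l -> ccont f z.
Proof.
  intros H. apply cderiv_slope in H. destruct H as [q [E [_ Q]]].
  apply ccont_ext with (f := fun y => (f z + (y + - z) * q y)%C) (r := 1).
  - lra.
  - intros y _. symmetry. apply E.
  - apply ccont_plus; [apply ccont_const|]. apply ccont_mult; [|exact Q].
    apply ccont_plus; [apply ccont_id|apply ccont_const].
Qed.

Lemma cderiv_const (c z : C) : cderiv (fun _ => c) z 0%C.
Proof.
  apply cderiv_slope. exists (fun _ => 0%C). split; [intros; ring|].
  split; [reflexivity|apply ccont_const].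
Qed.

Lemma cderiv_id (z : C) : cderiv (fun y => y) z 1%C.
Proof.
  apply cderiv_slope. exists (fun _ => 1%C). split; [intros; ring|].
  split; [reflexivity|apply ccont_const].
Qed.

Lemma cderiv_plus (f g : C -> C) (z lf lg : C) :
  cderiv f z lf -> cderiv g z lg -> cderiv (fun y => (f y + g y)%C) z (lf + lg)%C.
Proof.
  rewrite !cderiv_slope. intros [p [Ep [Lp Cp]]] [q [Eq [Lq Cq]]].
  exists (fun y => (p y + q y)%C). split; [|split].
  - intros y. rewrite (Ep y), (Eq y). ring.
  - now rewrite Lp, Lq.
  - now apply ccont_plus.
Qed.

Lemma cderiv_mult (f g : C -> C) (z lf lg : C) :
  cderiv f z lf -> cderiv g z lg ->
  cderiv (fun y => (f y * g y)%C) z (lf * g z + f z * lg)%C.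
Proof.
  intros Hf Hg. assert (Cg := cderiv_ccont _ _ _ Hg). revert Hf Hg.
  rewrite !cderiv_slope. intros [p [Ep [Lp Cp]]] [q [Eq [Lq Cq]]].
  exists (fun y => (p y * g y + f z * q y)%C). split; [|split].
  - intros y. rewrite (Ep y), (Eq y). ring.
  - now rewrite Lp, Lq.
  - apply ccont_plus; [now apply ccont_mult|].
    apply ccont_mult; [apply ccont_const|exact Cq].
Qed.

Lemma cderiv_comp (f g : C -> C) (z lf lg : C) :
  cderiv f z lf -> cderiv g (f z) lg -> cderiv (fun y => g (f y)) z (lf * lg)%C.
Proof.
  intros Hf Hg. assert (Cf := cderiv_ccont _ _ _ Hf). revert Hf Hg.
  rewrite !cderiv_slope. intros [p [Ep [Lp Cp]]] [q [Eq [Lq Cq]]].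
  exists (fun y => (p y * q (f y))%C). split; [|split].
  - intros y. rewrite (Eq (f y)), (Ep y) at 1. ring.
  - now rewrite Lp, Lq.
  - apply ccont_mult; [exact Cp|]. now apply (ccont_comp f q).
Qed.

Lemma cderiv_ext_loc (f g : C -> C) (z l : C) (r : R) :
  0 < r -> (forall y, Cmod (y - z) < r -> f y = g y) -> cderiv f z l -> cderiv g z l.
Proof.
  rewrite !cderiv_eps. intros Hr E H e He. destruct (H e He) as [d [D Hd]].
  exists (Rmin r d). split; [now apply Rmin_glb_lt|]. intros y Hy.
  rewrite <- !E.
  - apply Hd. eapply Rlt_le_trans; [exact Hy|apply Rmin_r].
  - rewrite Cmod_sub_self. exact Hr.
  - eapply Rlt_le_trans; [exact Hy|apply Rmin_l].
Qed.

Lemma cderiv_inv_at (z : C) : z <> 0%C -> cderiv (fun y => (/ y)%C) z (- / (z * z))%C.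
Proof.
  intros Hz. assert (P := proj1 (Cmod_gt_0 _) Hz).
  (* The identity 1/y = 1/z - (y - z)/(z y) holds only for y <> 0, hence the restriction to the disc
     of radius |z| about z. *)
  apply cderiv_ext_loc with (r := Cmod z)
    (f := fun y => (/ z + (y - z) * (- (/ z * (/ y))))%C); [exact P| |].
  - intros y Hy. assert (y <> 0%C).
    { intros E. subst y. rewrite Cmod_sub_sym in Hy.
      replace (z - 0)%C with z in Hy by ring. lra. }
    field. auto.
  - apply cderiv_slope. exists (fun y => (- (/ z * / y))%C). split; [|split].
    + intros y. ring.
    + field. exact Hz.
    + apply ccont_ext with (f := fun y => ((- / z) * / y)%C) (r := 1); [lra| |].
      * intros; ring.
      * apply ccont_mult; [apply ccont_const|]. apply ccont_inv; [exact Hz|apply ccont_id].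
Qed.

Lemma cderiv_div (f g : C -> C) (z lf lg : C) :
  g z <> 0%C -> cderiv f z lf -> cderiv g z lg ->
  cderiv (fun y => (f y / g y)%C) z ((lf * g z - f z * lg) / (g z * g z))%C.
Proof.
  intros N Hf Hg.
  replace ((lf * g z - f z * lg) / (g z * g z))%C
    with (lf * (/ g z) + f z * (lg * (- / (g z * g z))))%C by (field; exact N).
  apply (cderiv_mult f (fun y => / g y)%C); [exact Hf|].
  apply (cderiv_comp g (fun y => / y)%C); [exact Hg|]. now apply cderiv_inv_at.
Qed.

Lemma cderiv_unique (f : C -> C) (z l l' : C) : cderiv f z l -> cderiv f z l' -> l = l'.
Proof.
  intros H H'. apply is_C_derive_unique in H. apply is_C_derive_unique in H'. congruence.
Qed.

(** * Complex power series on the unit disc *)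

Definition cseries (u : nat -> C) (l : C) : Prop := @is_series C_AbsRing C_NormedModule u l.

Lemma cseries_ext (u v : nat -> C) (l : C) :
  (forall n, u n = v n) -> cseries u l -> cseries v l.
Proof. exact (@is_series_ext C_AbsRing C_NormedModule u v l). Qed.

Lemma cseries_unique (u : nat -> C) (l l' : C) : cseries u l -> cseries u l' -> l = l'.
Proof.
  exact (@filterlim_locally_unique nat C_AbsRing C_NormedModule eventually _ _ l l').
Qed.

Lemma cseries_plus (u v : nat -> C) (l m : C) :
  cseries u l -> cseries v m -> cseries (fun n => (u n + v n)%C) (l + m)%C.
Proof. exact (@is_series_plus C_AbsRing C_NormedModule u v l m). Qed.

Lemma cseries_scal (c : C) (u : nat -> C) (l : C) :
  cseries u l -> cseries (fun n => (c * u n)%C) (c * l)%C.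
Proof. exact (@is_series_scal C_AbsRing C_NormedModule c u l). Qed.

Lemma cseries_tail (u : nat -> C) (l : C) :
  cseries u l <-> cseries (fun n => u (S n)) (l - u 0%nat)%C.
Proof.
  split; intros H.
  - apply (@is_series_incr_1 C_AbsRing C_NormedModule u).
    change (cseries u (l - u 0%nat + u 0%nat)%C).
    replace (l - u 0%nat + u 0%nat)%C with l by ring. exact H.
  - apply (@is_series_decr_1 C_AbsRing C_NormedModule u). exact H.
Qed.

Lemma cseries_norm_le (u : nat -> C) (l : C) (b : nat -> R) :
  (forall n, Cmod (u n) <= b n) -> ex_series b -> cseries u l -> Cmod l <= Series b.
Proof.
  intros H Hb Hu. apply Series_correct in Hb.
  change (Rbar_le (Cmod l) (Series b)).
  apply (is_lim_seq_le (fun n => Cmod (@sum_n C_NormedModule u n)) (sum_n b)).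
  - intros n. eapply Rle_trans.
    + apply (@norm_sum_n_m C_AbsRing C_NormedModule u 0 n).
    + apply sum_n_m_le. exact H.
  - eapply filterlim_comp; [exact Hu|]. apply (@filterlim_norm C_AbsRing C_NormedModule).
  - exact Hb.
Qed.

Lemma cseries_exists (u : nat -> C) (b : nat -> R) :
  (forall n, Cmod (u n) <= b n) -> ex_series b -> exists l, cseries u l.
Proof. exact (@ex_series_le C_AbsRing C_CompleteNormedModule u b). Qed.

Lemma Cmod_le_add (y z : C) : Cmod z <= Cmod (y + z) + Cmod y.
Proof.
  replace z with ((y + z) + - y)%C at 1 by ring.
  eapply Rle_trans; [apply Cmod_triangle|]. rewrite Cmod_opp. lra.
Qed.

(** Convergent partial sums are bounded by some M, and a term is the difference of two of them,
    whence 2 M. *)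
Lemma cseries_bounded (u : nat -> C) (l : C) :
  cseries u l -> exists M, forall n, Cmod (u n) <= M.
Proof.
  intros H.
  destruct (@filterlim_bounded C_AbsRing C_NormedModule (@sum_n C_NormedModule u)) as [M HM].
  { now exists l. }
  assert (HM' : forall n, Cmod (@sum_n C_NormedModule u n) <= M) by exact HM.
  assert (P : 0 <= M) by (eapply Rle_trans; [apply Cmod_ge_0|apply (HM' 0%nat)]).
  exists (2 * M). intros [|n].
  - specialize (HM' 0%nat). rewrite sum_O in HM'. lra.
  - assert (B := HM' (S n)). rewrite sum_Sn in B. set (s := @sum_n C_NormedModule u n) in B.
    apply Rle_trans with (Cmod (s + u (S n)) + Cmod s).
    { apply Cmod_le_add. }
    assert (Cmod s <= M) by apply HM'. change (Cmod (s + u (S n)) <= M) in B. lra.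
Qed.

Lemma is_cpseries (a : nat -> C) (z l : C) :
  @is_pseries C_AbsRing C_NormedModule a z l <-> cseries (fun n => (a n * z ^ n)%C) l.
Proof.
  assert (E : forall n, (@scal C_AbsRing C_NormedModule (pow_n z n) (a n)) = (a n * z ^ n)%C).
  { intros n. change ((pow_n z n * a n)%C = (a n * z ^ n)%C).
    replace (@pow_n C_AbsRing z n) with (z ^ n)%C; [apply Cmult_comm|].
    induction n; simpl; [reflexivity|]. now rewrite IHn. }
  split; intros H.
  - eapply cseries_ext; [|exact H]. exact E.
  - eapply (cseries_ext _ _ _ (fun n => eq_sym (E n))). exact H.
Qed.

Lemma Cmod_RtoC_pos (x : R) : 0 <= x -> Cmod (RtoC x) = x.
Proof. intros H. rewrite Cmod_R. now apply Rabs_pos_eq. Qed.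

Lemma Cmod_pow_le (y : C) (r : R) (n : nat) : Cmod y <= r -> Cmod (y ^ n)%C <= r ^ n.
Proof. intros H. rewrite Cmod_pow. apply pow_incr. split; [apply Cmod_ge_0|exact H]. Qed.

(** Convergence at each real point r < 1 bounds |a_n| r^n. This hands the complex series over to the
    theory of the radius of convergence of the real series of moduli. *)
Lemma disk_radius (f : C -> C) (a : nat -> C) :
  taylor_coeffs f a -> Rbar_le 1 (CV_radius (fun n => Cmod (a n))).
Proof.
  intros H. apply Rbar_not_lt_le. intros L.
  set (A := fun n => Cmod (a n)) in *.
  assert (B := CV_radius_bounded A). destruct B as [U _].
  assert (K : forall r, 0 <= r < 1 -> Rbar_le r (CV_radius A)).
  { intros r Hr. apply U.
    assert (D : unit_disk (RtoC r)) by (unfold unit_disk, disk; rewrite Cmod_RtoC_pos; lra).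
    assert (S := H _ D). apply is_cpseries in S.
    destruct (cseries_bounded _ _ S) as [M HM]. exists M. intros n.
    unfold A. rewrite Rabs_mult, Rabs_pos_eq by apply Cmod_ge_0.
    specialize (HM n). rewrite Cmod_mult, Cmod_pow, Cmod_RtoC_pos in HM by lra.
    rewrite Rabs_pos_eq; [exact HM|]. apply pow_le; lra. }
  destruct (CV_radius A) as [c| |]; simpl in *.
  - assert (K0 := K 0 ltac:(lra)). assert (K1 := K ((c + 1) / 2) ltac:(lra)). lra.
  - exact L.
  - apply (K 0). lra.
Qed.

(** Formal differentiation keeps the radius of convergence. The three series majorise f, its
    derivative, and the second-order remainder used in termwise differentiation. *)
Lemma disk_abs_series (f : C -> C) (a : nat -> C) (r : R) :
  taylor_coeffs f a -> 0 <= r < 1 ->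
  ex_series (fun n => Cmod (a n) * r ^ n) /\
  ex_series (fun n => INR (S n) * Cmod (a (S n)) * r ^ n) /\
  ex_series (fun n => INR (S n) * (INR (S (S n)) * Cmod (a (S (S n)))) * r ^ n).
Proof.
  intros H Hr. assert (Rd := disk_radius f a H).
  set (A := fun n => Cmod (a n)) in *.
  assert (L : Rbar_lt (Rabs r) (CV_radius A)).
  { eapply Rbar_lt_le_trans; [|exact Rd]. simpl. rewrite Rabs_pos_eq; lra. }
  assert (P : forall n, 0 <= r ^ n) by (intros; apply pow_le; lra).
  assert (PA : forall n, 0 <= A n) by (intros; apply Cmod_ge_0).
  assert (E : forall b : nat -> R, (forall n, 0 <= b n) ->
    Rbar_lt (Rabs r) (CV_radius b) -> ex_series (fun n => b n * r ^ n)).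
  { intros b Pb Hb. eapply ex_series_ext; [|apply (CV_disk_inside b r Hb)].
    intros n. apply Rabs_pos_eq. now apply Rmult_le_pos. }
  split; [|split].
  - now apply E.
  - apply (E (PS_derive A)); [|now rewrite CV_radius_derive].
    intros n. apply Rmult_le_pos; [apply pos_INR|apply PA].
  - apply (E (PS_derive (PS_derive A))); [|now rewrite !CV_radius_derive].
    intros n. apply Rmult_le_pos; [apply pos_INR|].
    apply Rmult_le_pos; [apply pos_INR|apply PA].
Qed.

Definition cps_derive (a : nat -> C) (n : nat) : C := (RtoC (INR (S n)) * a (S n))%C.

Definition cpow_deriv (z : C) (n : nat) : C :=
  match n with O => 0%C | S m => (RtoC (INR (S m)) * z ^ m)%C end.

(** This is n (n-1) r^(n-2), the second derivative of r^n. The factor 1/2 of the sharp Taylor bound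
    is dropped, so that the weighted sum is exactly the third series of [disk_abs_series]. *)
Definition pow_taylor_bound (r : R) (n : nat) : R :=
  match n with S (S m) => INR (S m) * INR (S (S m)) * r ^ m | _ => 0 end.

(** Induction on the exponent: if R_n is the remainder on the left, then R_(n+1) = y R_n + n z^(n-1)
    (y - z)^2. *)
Lemma cpow_taylor (y z : C) (r : R) (n : nat) :
  Cmod y <= r -> Cmod z <= r ->
  Cmod (y ^ n - z ^ n - (y - z) * cpow_deriv z n)%C
    <= pow_taylor_bound r n * (Cmod (y - z) * Cmod (y - z)).
Proof.
  intros Hy Hz. assert (Hr : 0 <= r) by (eapply Rle_trans; [apply Cmod_ge_0|exact Hy]).
  set (d := Cmod (y - z)). assert (Hd : 0 <= d) by apply Cmod_ge_0.
  destruct n as [|n].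
  { simpl. replace (1 - 1 - (y - z) * 0)%C with (RtoC 0) by ring. rewrite Cmod_0. lra. }
  induction n as [|n IH].
  { simpl. replace (y * 1 - z * 1 - (y - z) * (1 * 1))%C with (RtoC 0) by ring.
    rewrite Cmod_0. lra. }
  replace (y ^ S (S n) - z ^ S (S n) - (y - z) * cpow_deriv z (S (S n)))%C
    with (y * (y ^ S n - z ^ S n - (y - z) * cpow_deriv z (S n))
          + RtoC (INR (S n)) * z ^ n * ((y - z) * (y - z)))%C.
  2:{ unfold cpow_deriv. rewrite (S_INR (S n)), RtoC_plus, !Cpow_S. ring. }
  eapply Rle_trans; [apply Cmod_triangle|]. rewrite !Cmod_mult. fold d.
  rewrite (Cmod_RtoC_pos (INR (S n))) by apply pos_INR.
  assert (Q := Cmod_pow_le z r n Hz).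
  assert (P := pow_le r n Hr). assert (I := pos_INR n).
  assert (T : INR (S n) * Cmod (z ^ n)%C * (d * d) <= INR (S n) * r ^ n * (d * d)).
  { apply Rmult_le_compat_r; [nra|]. apply Rmult_le_compat_l; [apply pos_INR|exact Q]. }
  assert (T2 : Cmod y * Cmod (y ^ S n - z ^ S n - (y - z) * cpow_deriv z (S n))
    <= r * (pow_taylor_bound r (S n) * (d * d))).
  { apply Rmult_le_compat; auto; apply Cmod_ge_0. }
  eapply Rle_trans; [apply Rplus_le_compat; [exact T2|exact T]|].
  assert (Z : r * pow_taylor_bound r (S n) + INR (S n) * r ^ n
     <= pow_taylor_bound r (S (S n))).
  { destruct n as [|n]; [simpl; lra|].
    unfold pow_taylor_bound. rewrite !S_INR in *. simpl (r ^ S n) in *.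
    assert (0 <= r * r ^ n) by exact P.
    assert (0 <= INR n) by apply pos_INR. nra. }
  apply (Rmult_le_compat_r (d * d)) in Z; [|nra].
  rewrite !Rmult_plus_distr_r in Z. lra.
Qed.

(** Summing the remainders of the powers gives |f(y) - f(z) - (y - z) f'(z)| <= M |y - z|^2 for y
    near z. The conclusion again has the form [taylor_coeffs], so the lemma can be iterated. *)
Lemma cpseries_derive (f : C -> C) (a : nat -> C) :
  taylor_coeffs f a ->
  exists f', taylor_coeffs f' (cps_derive a) /\
    forall z, unit_disk z -> cderiv f z (f' z).
Proof.
  intros H.
  assert (Ex : forall z, exists l, unit_disk z ->
    @is_pseries C_AbsRing C_NormedModule (cps_derive a) z l).
  { intros z. destruct (Rlt_dec (Cmod z) 1) as [D|D]; [|exists (RtoC 0); intros; contradiction].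
    destruct (disk_abs_series f a (Cmod z) H) as [_ [S1 _]].
    { split; [apply Cmod_ge_0|exact D]. }
    destruct (cseries_exists (fun n => cps_derive a n * z ^ n)%C
      (fun n => INR (S n) * Cmod (a (S n)) * Cmod z ^ n)) as [l Hl]; [|exact S1|].
    - intros n. unfold cps_derive. rewrite !Cmod_mult, Cmod_pow, Cmod_RtoC_pos by apply pos_INR.
      lra.
    - exists l. intros _. now apply is_cpseries. }
  destruct (functional_choice _ Ex) as [f' Hf'].
  exists f'. split; [exact Hf'|]. change (C -> C) in f'.
  intros z Dz. unfold unit_disk, disk in Dz.
  (* A radius strictly between |z| and 1: the majorant converges at r, and a neighbourhood of z
     stays inside |y| <= r. *)
  set (r := (1 + Cmod z) / 2). assert (Pz := Cmod_ge_0 z).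
  assert (Hr : Cmod z < r < 1) by (unfold r; lra).
  destruct (disk_abs_series f a r H) as [_ [_ S2]]; [lra|].
  set (b := fun n => Cmod (a n) * pow_taylor_bound r n).
  assert (Hb : ex_series b).
  { assert (E : forall n, INR (S n) * (INR (S (S n)) * Cmod (a (S (S n)))) * r ^ n
      = b (2 + n)%nat).
    { intros n. unfold b. simpl (2 + n)%nat. unfold pow_taylor_bound. ring. }
    apply (ex_series_incr_n b 2). exact (ex_series_ext _ _ E S2). }
  set (M := Series b).
  assert (PM : 0 <= M).
  { apply Rle_trans with (Cmod 0); [rewrite Cmod_0; lra|].
    apply (cseries_norm_le (fun _ => 0%C) 0%C b); [|exact Hb|].
    - intros n. rewrite Cmod_0. unfold b, pow_taylor_bound.
      apply Rmult_le_pos; [apply Cmod_ge_0|]. destruct n as [|[|n]]; try lra.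
      apply Rmult_le_pos; [apply Rmult_le_pos; apply pos_INR|apply pow_le; lra].
    - assert (X := H 0%C). apply is_cpseries in X.
      2:{ unfold unit_disk, disk. rewrite Cmod_0. lra. }
      apply (cseries_scal 0%C) in X. rewrite Cmult_0_l in X.
      eapply cseries_ext; [|exact X]. intros n. simpl. ring. }
  apply cderiv_eps. intros e He.
  (* The first bound keeps |y| <= r, the second makes M |y - z| <= e; M + 1 avoids division by
     zero. *)
  exists (Rmin (r - Cmod z) (e / (M + 1))). split.
  { apply Rmin_glb_lt; [lra|]. apply Rdiv_lt_0_compat; lra. }
  intros y Hy.
  assert (Hy1 := Rlt_le_trans _ _ _ Hy (Rmin_l _ _)).
  assert (Hy2 := Rlt_le_trans _ _ _ Hy (Rmin_r _ _)).
  assert (Yr : Cmod y <= r) by (assert (T := Cmod_le_sub y z); lra).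
  assert (Dy : unit_disk y) by (unfold unit_disk, disk; lra).
  assert (Sy := H y Dy). assert (Sz := H z Dz). assert (Sd := Hf' z Dz).
  rewrite is_cpseries in Sy, Sz, Sd.
  assert (Sd' : cseries (fun n => a n * cpow_deriv z n)%C (f' z)).
  { apply cseries_tail. change (cpow_deriv z 0) with (RtoC 0).
    rewrite Cmult_0_r. unfold Cminus at 1. rewrite Copp_0, Cplus_0_r.
    eapply cseries_ext; [|exact Sd]. intros n. unfold cps_derive, cpow_deriv. ring. }
  assert (K : cseries (fun n => a n * (y ^ n - z ^ n - (y - z) * cpow_deriv z n))%C
    (f y - f z - (y - z) * f' z)%C).
  { replace (f y - f z - (y - z) * f' z)%C
      with (f y + (- RtoC 1 * f z + (- (y - z)) * f' z))%C by ring.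
    eapply cseries_ext.
    2:{ apply cseries_plus; [exact Sy|].
        apply cseries_plus; apply cseries_scal; [exact Sz|exact Sd']. }
    intros n. simpl. ring. }
  set (d := Cmod (y - z)) in *. assert (Pd : 0 <= d) by apply Cmod_ge_0.
  assert (Q := cseries_norm_le _ _ (fun n => b n * (d * d)) (fun n =>
    ltac:(unfold b; rewrite Cmod_mult, Rmult_assoc;
      apply Rmult_le_compat_l; [apply Cmod_ge_0|apply cpow_taylor; lra]))
    (ex_series_scal_r (d * d) b Hb) K).
  rewrite Series_scal_r in Q. fold M in Q.
  apply Rlt_div_r in Hy2; [|lra]. nra.
Qed.

(** * The Schwarz lemma *)

(** Derivative of a curve in the plane. It serves as a bridge: the complex chain rule applies to it
    directly, and its two components are ordinary real derivatives. *)
Definition rderiv (g : R -> C) (t : R) (d : C) : Prop :=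
  forall eps, 0 < eps -> exists del, 0 < del /\ forall s, Rabs (s - t) < del ->
    Cmod (g s - g t - RtoC (s - t) * d) <= eps * Rabs (s - t).

Lemma Cmod_le_abs (z : C) : Cmod z <= Rabs (fst z) + Rabs (snd z).
Proof.
  destruct z as [x y]. replace (x, y) with (RtoC x + (0, y))%C.
  2:{ unfold Cplus, RtoC. simpl. f_equal; ring. }
  eapply Rle_trans; [apply Cmod_triangle|]. rewrite Cmod_R. simpl.
  apply Rplus_le_compat; [right; f_equal; ring|].
  unfold Cmod. simpl. right. replace (0 * (0 * 1) + y * (y * 1)) with (Rsqr y)
    by (unfold Rsqr; ring). rewrite sqrt_Rsqr_abs. f_equal. ring.
Qed.

Lemma fst_le_Cmod (z : C) : Rabs (fst z) <= Cmod z.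
Proof. eapply Rle_trans; [apply Rmax_l|apply Rmax_Cmod]. Qed.

Lemma snd_le_Cmod (z : C) : Rabs (snd z) <= Cmod z.
Proof. eapply Rle_trans; [apply Rmax_r|apply Rmax_Cmod]. Qed.

Lemma is_derive_eps (f : R -> R) (t l : R) :
  is_derive f t l <->
  (forall eps, 0 < eps -> exists d, 0 < d /\ forall s, Rabs (s - t) < d ->
     Rabs (f s - f t - (s - t) * l) <= eps * Rabs (s - t)).
Proof.
  split.
  - intros [_ H] e He.
    destruct (H t (fun P Q => Q) (mkposreal e He)) as [d Hd].
    exists d. split; [apply cond_pos|]. intros y Hy. exact (Hd y Hy).
  - intros H. split; [apply is_linear_scal_l|].
    intros x Hx e. apply (@is_filter_lim_locally_unique R_AbsRing R_NormedModule) in Hx.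
    subst x. destruct (H e (cond_pos e)) as [d [D Hd]].
    exists (mkposreal d D). intros y Hy. exact (Hd y Hy).
Qed.

Lemma rderiv_components (g : R -> C) (t : R) (d : C) :
  rderiv g t d <->
  is_derive (fun s => fst (g s)) t (fst d) /\ is_derive (fun s => snd (g s)) t (snd d).
Proof.
  assert (F : forall s, fst (g s - g t - RtoC (s - t) * d)%C
    = fst (g s) - fst (g t) - (s - t) * fst d) by (intros; simpl; ring).
  assert (S : forall s, snd (g s - g t - RtoC (s - t) * d)%C
    = snd (g s) - snd (g t) - (s - t) * snd d) by (intros; simpl; ring).
  rewrite !is_derive_eps. split.
  - intros H. split; intros e He; destruct (H e He) as [del [D Hd]];
      exists del; (split; [exact D|]); intros s Hs.
    + rewrite <- F. eapply Rle_trans; [apply fst_le_Cmod|auto].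
    + rewrite <- S. eapply Rle_trans; [apply snd_le_Cmod|auto].
  - intros [H1 H2] e He.
    destruct (H1 (e/2)) as [d1 [D1 K1]]; [lra|].
    destruct (H2 (e/2)) as [d2 [D2 K2]]; [lra|].
    exists (Rmin d1 d2). split; [now apply Rmin_glb_lt|]. intros s Hs.
    assert (A := K1 s (Rlt_le_trans _ _ _ Hs (Rmin_l _ _))).
    assert (B := K2 s (Rlt_le_trans _ _ _ Hs (Rmin_r _ _))).
    eapply Rle_trans; [apply Cmod_le_abs|]. rewrite F, S. lra.
Qed.

Lemma rderiv_comp (f : C -> C) (g : R -> C) (t : R) (l d : C) :
  cderiv f (g t) l -> rderiv g t d -> rderiv (fun s => f (g s)) t (d * l)%C.
Proof.
  rewrite cderiv_eps. intros Hf Hg e He.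
  assert (Pd := Cmod_ge_0 d). assert (Pl := Cmod_ge_0 l).
  set (e1 := e / (2 * (Cmod d + 1))). set (e2 := e / (2 * (Cmod l + 1))).
  assert (E1 : 0 < e1) by (apply Rdiv_lt_0_compat; lra).
  assert (E2 : 0 < e2) by (apply Rdiv_lt_0_compat; lra).
  destruct (Hf e1 E1) as [r [Pr Hr]].
  destruct (Hg 1 Rlt_0_1) as [d1 [D1 H1]].
  destruct (Hg e2 E2) as [d2 [D2 H2]].
  exists (Rmin d1 (Rmin d2 (r / (Cmod d + 1)))). split.
  { repeat apply Rmin_glb_lt; try lra. apply Rdiv_lt_0_compat; lra. }
  intros s Hs.
  assert (S1 := Rlt_le_trans _ _ _ Hs (Rmin_l _ _)).
  assert (S' := Rlt_le_trans _ _ _ Hs (Rmin_r _ _)).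
  assert (S2 := Rlt_le_trans _ _ _ S' (Rmin_l _ _)).
  assert (S3 := Rlt_le_trans _ _ _ S' (Rmin_r _ _)).
  apply Rlt_div_r in S3; [|lra].
  set (h := Rabs (s - t)) in *. assert (Ph : 0 <= h) by apply Rabs_pos.
  assert (G : Cmod (g s - g t) <= h * (Cmod d + 1)).
  { replace (g s - g t)%C with ((g s - g t - RtoC (s - t) * d) + RtoC (s - t) * d)%C by ring.
    eapply Rle_trans; [apply Cmod_triangle|]. rewrite Cmod_mult, Cmod_R. fold h.
    assert (X := H1 s S1). fold h in X. nra. }
  replace (f (g s) - f (g t) - RtoC (s - t) * (d * l))%C
    with ((f (g s) - f (g t) - (g s - g t) * l) + (g s - g t - RtoC (s - t) * d) * l)%C by ring.
  eapply Rle_trans; [apply Cmod_triangle|]. rewrite Cmod_mult.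
  assert (X := Hr (g s) (Rle_lt_trans _ _ _ G S3)).
  assert (Y := H2 s S2). fold h in Y.
  assert (X' : Cmod (f (g s) - f (g t) - (g s - g t) * l) <= e / 2 * h).
  { eapply Rle_trans; [exact X|]. replace (e / 2 * h) with (e1 * (h * (Cmod d + 1)))
      by (unfold e1; field; lra). apply Rmult_le_compat_l; lra. }
  assert (Y' : Cmod (g s - g t - RtoC (s - t) * d) * Cmod l <= e / 2 * h).
  { apply Rle_trans with ((e2 * h) * (Cmod l + 1)).
    - apply Rmult_le_compat; try apply Cmod_ge_0; lra.
    - right. unfold e2. field. lra. }
  lra.
Qed.

(** The point e^(s + i th). With the logarithm of the radius as coordinate the two partial
    derivatives are z and i z, so the Cauchy-Riemann equations carry no factor of the radius; s < 0
    is the punctured unit disc and the origin is the limit s to minus infinity. *)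
Definition polar (s th : R) : C := (exp s * cos th, exp s * sin th).

Lemma Cmod_polar (s th : R) : Cmod (polar s th) = exp s.
Proof.
  unfold Cmod, polar. simpl.
  replace (exp s * cos th * (exp s * cos th * 1) + exp s * sin th * (exp s * sin th * 1))
    with (Rsqr (exp s) * (Rsqr (sin th) + Rsqr (cos th))) by (unfold Rsqr; ring).
  rewrite sin2_cos2, Rmult_1_r. apply sqrt_Rsqr. left. apply exp_pos.
Qed.

Lemma polar_neq0 (s th : R) : polar s th <> 0%C.
Proof. apply Cmod_gt_0. rewrite Cmod_polar. apply exp_pos. Qed.

Lemma polar_disk (s th : R) : s < 0 -> unit_disk (polar s th).
Proof.
  intros H. unfold unit_disk, disk. rewrite Cmod_polar, <- exp_0. now apply exp_increasing.
Qed.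

Lemma rderiv_polar_radial (s th : R) : rderiv (fun u => polar u th) s (polar s th).
Proof.
  apply rderiv_components. unfold polar. simpl.
  split; auto_derive; trivial; ring.
Qed.

Lemma rderiv_polar_angular (s th : R) : rderiv (fun v => polar s v) th (Ci * polar s th)%C.
Proof.
  apply rderiv_components. unfold polar, Ci. simpl.
  split; auto_derive; trivial; ring.
Qed.

Lemma continuity_2d_polar (f : C -> C) (s th : R) :
  ccont f (polar s th) ->
  continuity_2d_pt (fun u v => fst (f (polar u v))) s th /\
  continuity_2d_pt (fun u v => snd (f (polar u v))) s th.
Proof.
  intros Hf.
  assert (P : forall trig, continuity trig ->
    continuity_2d_pt (fun u v => exp u * trig v) s th).
  { intros trig Ht. apply continuity_2d_pt_mult.
    - apply (continuity_1d_2d_pt_comp exp (fun u _ => u)); [|apply continuity_2d_pt_id1].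
      apply derivable_continuous_pt, derivable_pt_exp.
    - apply (continuity_1d_2d_pt_comp trig (fun _ v => v)); [|apply continuity_2d_pt_id2].
      apply Ht. }
  assert (Pc := P cos continuity_cos). assert (Ps := P sin continuity_sin).
  assert (K : forall e : posreal, exists d : posreal, forall u v,
    Rabs (u - s) < d -> Rabs (v - th) < d -> Cmod (f (polar u v) - f (polar s th)) < e).
  { intros e. destruct (Hf e (cond_pos e)) as [r [Pr Hr]].
    destruct (Pc (mkposreal (r/2) ltac:(lra))) as [d1 H1].
    destruct (Ps (mkposreal (r/2) ltac:(lra))) as [d2 H2].
    exists (mkposreal _ (Rmin_pos _ _ (cond_pos d1) (cond_pos d2))). simpl.
    intros u v Hu Hv. apply Hr. eapply Rle_lt_trans; [apply Cmod_le_abs|].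
    assert (A := H1 u v (Rlt_le_trans _ _ _ Hu (Rmin_l _ _)) (Rlt_le_trans _ _ _ Hv (Rmin_l _ _))).
    assert (B := H2 u v (Rlt_le_trans _ _ _ Hu (Rmin_r _ _)) (Rlt_le_trans _ _ _ Hv (Rmin_r _ _))).
    simpl in *. unfold Rminus in *. lra. }
  split; intros e; destruct (K e) as [d Hd]; exists d; intros u v Hu Hv;
    (eapply Rle_lt_trans; [|apply (Hd u v Hu Hv)]).
  - apply (fst_le_Cmod (f (polar u v) - f (polar s th))).
  - apply (snd_le_Cmod (f (polar u v) - f (polar s th))).
Qed.

Lemma continuous_2d_snd (F : R -> R -> R) (s th : R) :
  continuity_2d_pt F s th -> continuous (F s) th.
Proof.
  intros H P [e He]. destruct (H e) as [d Hd]. exists d. intros v Hv. apply He.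
  apply (Hd s v); [|exact Hv]. rewrite Rminus_diag. rewrite Rabs_R0. apply cond_pos.
Qed.

(* In the coordinates z = e^(s + i th), U + iV = w(z)/z satisfies U_s = V_th;
   by 2 pi-periodicity the angular mean of U does not depend on s. *)
Lemma Schwarz_re (w w' : C -> C) :
  (forall z, unit_disk z -> cderiv w z (w' z)) ->
  (forall z, unit_disk z -> ccont w' z) ->
  (forall z, unit_disk z -> Cmod (w z) < 1) ->
  w 0%C = 0%C -> fst (w' 0%C) <= 1.
Proof.
  intros Hd Hc Hb H0.
  set (q := fun z => (w z / z)%C).
  (* [h] is z q'(z). Along a ray q has derivative h, along a circle i h; the real part of the first
     and the imaginary part of the second are both Re h. *)
  set (h := fun z => (w' z - w z / z)%C).
  set (U := fun s th => fst (q (polar s th))).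
  set (V := fun s th => snd (q (polar s th))).
  assert (Hq : forall s th, s < 0 -> cderiv q (polar s th) (h (polar s th) / polar s th)%C).
  { intros s th Hs. assert (N := polar_neq0 s th).
    replace (h (polar s th) / polar s th)%C with
      ((w' (polar s th) * polar s th - w (polar s th) * 1) / (polar s th * polar s th))%C
      by (unfold h; field; exact N).
    apply (cderiv_div w (fun z => z)); [exact N| |apply cderiv_id].
    now apply Hd, polar_disk. }
  assert (Hh : forall s th, s < 0 -> ccont h (polar s th)).
  { intros s th Hs. assert (N := polar_neq0 s th). assert (D := polar_disk s th Hs).
    unfold h. apply ccont_ext with (r := 1)
      (f := fun z => (w' z + (- RtoC 1) * (w z * / z))%C); [lra| |].
    - intros y _. unfold Cdiv, Cminus. ring.
    - apply ccont_plus; [now apply Hc|]. apply ccont_mult; [apply ccont_const|].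
      apply ccont_mult; [eapply cderiv_ccont; now apply Hd|].
      apply ccont_inv; [exact N|apply ccont_id]. }
  assert (Us : forall s th, s < 0 -> is_derive (fun u => U u th) s (fst (h (polar s th)))).
  { intros s th Hs. assert (N := polar_neq0 s th).
    assert (X := rderiv_comp q _ s _ _ (Hq s th Hs) (rderiv_polar_radial s th)).
    replace (polar s th * (h (polar s th) / polar s th))%C with (h (polar s th)) in X
      by (field; exact N).
    apply rderiv_components in X. apply X. }
  assert (Vt : forall s th, s < 0 -> is_derive (V s) th (fst (h (polar s th)))).
  { intros s th Hs. assert (N := polar_neq0 s th).
    assert (X := rderiv_comp q _ th _ _ (Hq s th Hs) (rderiv_polar_angular s th)).
    replace (Ci * polar s th * (h (polar s th) / polar s th))%C with (Ci * h (polar s th))%C in X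
      by (field; exact N).
    apply rderiv_components in X. destruct X as [_ X].
    replace (fst (h (polar s th))) with (snd (Ci * h (polar s th))%C); [exact X|].
    simpl. ring. }
  assert (Cont : forall s th, s < 0 -> continuous (U s) th).
  { intros s th Hs. apply continuous_2d_snd. apply continuity_2d_polar.
    eapply cderiv_ccont. now apply Hq. }
  assert (Ex : forall s, s < 0 -> ex_RInt (U s) 0 (2 * PI)).
  { intros s Hs. apply (@ex_RInt_continuous R_CompleteNormedModule).
    intros th _. now apply Cont. }
  assert (Near : forall s, s < 0 -> locally s (fun u => u < 0)).
  { intros s Hs. apply (open_lt 0). exact Hs. }
  set (J := fun s => RInt (U s) 0 (2 * PI)).
  assert (J' : forall s, s < 0 -> is_derive J s 0).
  { intros s Hs.
    replace 0 with (RInt (fun th => Derive (fun u => U u th) s) 0 (2 * PI)).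
    - apply (is_derive_RInt_param U 0 (2 * PI) s).
      + eapply filter_imp; [|apply (Near s Hs)]. intros u Hu th _.
        eexists. now apply Us.
      + intros th _.
        (* Differentiation under the integral asks for joint continuity of U_s, which rests on the
           continuity of w' through [h]. *)
        apply continuity_2d_pt_ext_loc with (f := fun u v => fst (h (polar u v))).
        * exists (mkposreal (- s) ltac:(lra)). simpl. intros u v Hu _.
          symmetry. apply is_derive_unique, Us. apply Rabs_def2 in Hu. lra.
        * apply (continuity_2d_polar h). now apply Hh.
      + eapply filter_imp; [|apply (Near s Hs)]. intros u Hu. now apply Ex.
    - assert (Du : forall th, Derive (fun u : R => U u th) s = fst (h (polar s th))).
      { intros th. now apply is_derive_unique, Us. }
      apply is_RInt_unique.
      replace 0 with (minus (V s (2 * PI)) (V s 0)) at 2.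
      2:{ unfold V, polar. rewrite cos_2PI, sin_2PI, cos_0, sin_0. apply Rminus_diag. }
      apply (is_RInt_derive (V s)).
      + intros th _. rewrite Du. now apply Vt.
      + intros th _. apply continuous_ext with (f := fun v => fst (h (polar s v))).
        * intros v. symmetry. apply Du.
        * apply (continuous_2d_snd (fun u v => fst (h (polar u v)))).
          apply (continuity_2d_polar h). now apply Hh. }
  assert (Jc : forall s t, s < t < 0 -> J s = J t).
  { intros s t [H1 H2]. apply (eq_is_derive J s t); [|exact H1].
    intros u Hu. apply J'. lra. }
  assert (PP := PI_RGT_0).
  (* On the circle |z| = e^s the bound |w| < 1 gives |w(z)/z| < e^(-s), close to 1 near the unit
     circle. *)
  assert (Up : forall s, s < 0 -> J s <= 2 * PI * exp (- s)).
  { intros s Hs.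
    replace (2 * PI * exp (- s)) with (RInt (fun _ => exp (- s)) 0 (2 * PI))
      by (rewrite RInt_const; unfold scal; simpl; unfold mult; simpl; ring).
    apply RInt_le; [lra|now apply Ex|apply ex_RInt_const|].
    intros th _. unfold U.
    eapply Rle_trans; [apply Rle_abs|]. eapply Rle_trans; [apply fst_le_Cmod|].
    unfold q. rewrite Cmod_div by apply polar_neq0. rewrite Cmod_polar, exp_Ropp.
    rewrite <- (Rmult_1_l (/ exp s)). apply Rmult_le_compat_r.
    - left. apply Rinv_0_lt_compat, exp_pos.
    - left. now apply Hb, polar_disk. }
  (* On small circles w(z)/z is within e of w'(0). Since the mean is constant, this lower bound
     meets the upper bound taken near the unit circle. *)
  assert (Low : forall e, 0 < e -> exists s0, s0 < 0 /\
    forall s, s < s0 -> 2 * PI * (fst (w' 0%C) - e) <= J s).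
  { intros e He.
    assert (D0 : unit_disk 0%C) by (unfold unit_disk, disk; rewrite Cmod_0; lra).
    assert (X := Hd _ D0). rewrite cderiv_eps in X. destruct (X e He) as [d [D Hdd]].
    exists (Rmin (-1) (ln d)). split; [eapply Rle_lt_trans; [apply Rmin_l|lra]|].
    intros s Hs.
    assert (S1 := Rlt_le_trans _ _ _ Hs (Rmin_l _ _)).
    assert (S2 := Rlt_le_trans _ _ _ Hs (Rmin_r _ _)).
    replace (2 * PI * (fst (w' 0%C) - e)) with (RInt (fun _ => fst (w' 0%C) - e) 0 (2 * PI))
      by (rewrite RInt_const; unfold scal; simpl; unfold mult; simpl; ring).
    apply RInt_le; [lra|apply ex_RInt_const|apply Ex; lra|].
    intros th _. unfold U. assert (N := polar_neq0 s th).
    assert (P := exp_pos s).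
    assert (Y := Hdd (polar s th)).
    replace (polar s th - 0)%C with (polar s th) in Y by ring.
    rewrite Cmod_polar, H0 in Y.
    assert (L : exp s < d) by (rewrite <- (exp_ln d D); now apply exp_increasing).
    specialize (Y L).
    replace (w (polar s th) - 0 - polar s th * w' 0%C)%C
      with ((q (polar s th) - w' 0%C) * polar s th)%C in Y by (unfold q; field; exact N).
    rewrite Cmod_mult, Cmod_polar in Y. apply Rmult_le_reg_r in Y; [|exact P].
    assert (Z := fst_le_Cmod (q (polar s th) - w' 0%C)).
    assert (Z' : Rabs (fst (q (polar s th)) - fst (w' 0%C)) <= e) by exact (Rle_trans _ _ _ Z Y).
    apply Rabs_le_between in Z'. lra. }
  apply Rnot_lt_le. intros Hgt.
  set (l := fst (w' 0%C)) in *.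
  destruct (Low ((l - 1) / 2)) as [s0 [N0 Hs0]]; [lra|].
  (* The lower bound with e = (l - 1)/2 puts the mean at (1 + l)/2 or more. Here e^(-t) is the
     midpoint of 1 and (1 + l)/2, so the upper bound at t falls short of it when l > 1. *)
  set (t := - ln ((3 + l) / 4)).
  assert (T : t < 0).
  { unfold t. assert (0 < ln ((3 + l) / 4)); [|lra]. rewrite <- ln_1. apply ln_increasing; lra. }
  set (s := Rmin s0 t - 1).
  assert (Q1 := Rmin_l s0 t). assert (Q2 := Rmin_r s0 t).
  assert (A := Hs0 s ltac:(unfold s; lra)).
  assert (B := Up t T). rewrite (Jc s t) in A by (unfold s; lra).
  replace (exp (- t)) with ((3 + l) / 4) in B
    by (unfold t; rewrite Ropp_involutive, exp_ln; lra).
  assert (0 < 2 * PI * (l - 1)) by (apply Rmult_lt_0_compat; lra). lra.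
Qed.

(** Multiplying w by the unimodular constant conj(l)/|l|, with l = w'(0), turns the derivative at 0
    into the real number |l|, to which the bound on the real part applies. *)
Lemma Schwarz_derivative (w w' : C -> C) :
  (forall z, unit_disk z -> cderiv w z (w' z)) ->
  (forall z, unit_disk z -> ccont w' z) ->
  (forall z, unit_disk z -> Cmod (w z) < 1) ->
  w 0%C = 0%C -> Cmod (w' 0%C) <= 1.
Proof.
  intros Hd Hc Hb H0.
  destruct (Req_dec (Cmod (w' 0%C)) 0) as [E|N]; [lra|].
  set (l := w' 0%C) in *. assert (P := Cmod_ge_0 l).
  set (k := (Cconj l / RtoC (Cmod l))%C).
  assert (Nl : RtoC (Cmod l) <> 0%C) by (intros E; apply N; now apply RtoC_inj).
  assert (K : Cmod k = 1).
  { unfold k. rewrite Cmod_div by exact Nl. rewrite Cmod_conj, Cmod_RtoC_pos by exact P.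
    field. exact N. }
  assert (Kl : (k * l)%C = RtoC (Cmod l)).
  { replace (k * l)%C with ((l * Cconj l) / RtoC (Cmod l))%C by (unfold k; field; exact Nl).
    rewrite <- Cmod2_conj, RtoC_pow. field. exact Nl. }
  replace (Cmod l) with (fst (k * l)%C) by (now rewrite Kl).
  apply (Schwarz_re (fun z => (k * w z)%C) (fun z => (k * w' z)%C)).
  - intros z Dz. replace (k * w' z)%C with (0 * w z + k * w' z)%C by ring.
    apply (cderiv_mult (fun _ => k) w); [apply cderiv_const|now apply Hd].
  - intros z Dz. apply (ccont_mult (fun _ => k) w'); [apply ccont_const|now apply Hc].
  - intros z Dz. rewrite Cmod_mult, K, Rmult_1_l. now apply Hb.
  - rewrite H0. ring.
Qed.

(** * The coefficient bound *)

Lemma unit_disk0 : unit_disk 0%C.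
Proof. unfold unit_disk, disk. rewrite Cmod_0. lra. Qed.

Lemma cderiv_ext_disk (f g : C -> C) (z l : C) :
  unit_disk z -> (forall y, unit_disk y -> f y = g y) -> cderiv f z l -> cderiv g z l.
Proof.
  unfold unit_disk, disk. intros Hz E. apply cderiv_ext_loc with (r := 1 - Cmod z); [lra|].
  intros y Hy. apply E. assert (T := Cmod_le_sub y z). lra.
Qed.

Lemma cderiv_phi_car (z : C) : cderiv phi_car z (1 + z)%C.
Proof.
  unfold phi_car.
  replace (1 + z)%C with (0 + 1 + ((1 * z + z * 1) * / 2 + z * z * 0))%C
    by (field; intros E; apply RtoC_inj in E; lra).
  apply (cderiv_plus (fun y => 1 + y)%C (fun y => y * y / 2)%C).
  - apply (cderiv_plus (fun _ => RtoC 1) (fun y => y)); [apply cderiv_const|apply cderiv_id].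
  - apply (cderiv_mult (fun y => y * y)%C (fun _ => / 2)%C); [|apply cderiv_const].
    apply (cderiv_mult (fun y => y) (fun y => y)); apply cderiv_id.
Qed.

Lemma taylor_coeffs_0 (f : C -> C) (a : nat -> C) : taylor_coeffs f a -> f 0%C = a 0%nat.
Proof.
  intros H. specialize (H _ unit_disk0).
  exact (@filterlim_locally_unique nat C_AbsRing C_NormedModule eventually _ _ _ _ H
    (@is_pseries_0 C_AbsRing C_NormedModule a)).
Qed.

Lemma taylor_coeffs_div_id (f : C -> C) (a : nat -> C) :
  taylor_coeffs f a -> a 0%nat = 0%C ->
  exists g, taylor_coeffs g (fun n => a (S n)) /\ forall z, unit_disk z -> f z = (z * g z)%C.
Proof.
  intros H H0.
  (* The quotient has no meaningful value at 0; its limit there is the constant term of the shifted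
     series. *)
  exists (fun z => if Req_EM_T (Cmod z) 0 then a 1%nat else (f z / z)%C). split.
  - intros z Hz. destruct (Req_EM_T (Cmod z) 0) as [E|N].
    + apply Cmod_eq_0 in E. subst z.
      exact (@is_pseries_0 C_AbsRing C_NormedModule (fun n => a (S n))).
    + assert (Nz : z <> 0%C) by (intros E; apply N; rewrite E; apply Cmod_0).
      apply is_cpseries. specialize (H z Hz). apply is_cpseries in H.
      apply cseries_tail in H. apply (cseries_scal (/ z)) in H.
      replace (f z / z)%C with (/ z * (f z - a 0%nat * z ^ 0))%C.
      2:{ rewrite H0. simpl. field. exact Nz. }
      eapply cseries_ext; [|exact H]. intros n. simpl. field. exact Nz.
  - intros z Hz. destruct (Req_EM_T (Cmod z) 0) as [E|N].
    + apply Cmod_eq_0 in E. subst z. rewrite (taylor_coeffs_0 f a H), H0. ring.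
    + field. intros E; apply N; rewrite E; apply Cmod_0.
Qed.

Lemma one_plus_neq0 (u : C) : Cmod u < 1 -> (1 + u)%C <> 0%C.
Proof.
  intros H E. replace u with (- (1))%C in H.
  - rewrite Cmod_m1 in H. lra.
  - replace u with ((1 + u) - 1)%C by ring. rewrite E. ring.
Qed.

Lemma S_car_coeff2 (f : C -> C) (a : nat -> C) :
  taylor_coeffs f a -> a 0%nat = 0%C -> a 1%nat = 1%C -> S_car f -> Cmod (a 2%nat) <= 1.
Proof.
  intros Hf H0 H1 [_ [f' [Hf' [Nf [w [Aw [Bw [W0 Hw]]]]]]]].
  destruct (taylor_coeffs_div_id f a Hf H0) as [g [Hg Eg]].
  destruct (cpseries_derive _ _ Hg) as [g1 [Hg1 Dg]].
  destruct (cpseries_derive _ _ Hg1) as [g2 [Hg2 Dg1]].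
  (* The derivative [F1] of z f'/f contains [g2]; one more differentiation is made to know that [g2]
     is continuous. *)
  destruct (cpseries_derive _ _ Hg2) as [g3 [_ Dg2]].
  assert (G0 : g 0%C = 1%C) by (rewrite (taylor_coeffs_0 _ _ Hg); exact H1).
  assert (G1 : g1 0%C = a 2%nat).
  { rewrite (taylor_coeffs_0 _ _ Hg1). unfold cps_derive. simpl. ring. }
  assert (Ng : forall z, unit_disk z -> g z <> 0%C).
  { intros z Hz E. destruct (Req_EM_T (Cmod z) 0) as [Ez|Nz].
    - apply Cmod_eq_0 in Ez. subst z. rewrite G0 in E. apply RtoC_inj in E. lra.
    - apply (Nf z Hz).
      + intros Ez. apply Nz. rewrite Ez. apply Cmod_0.
      + rewrite (Eg z Hz), E. ring. }
  set (F := fun z => (1 + z * g1 z / g z)%C).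
  set (F1 := fun z => (((1 * g1 z + z * g2 z) * g z - (z * g1 z) * g1 z) / (g z * g z))%C).
  assert (EF : forall z, unit_disk z -> F z = phi_car (w z)).
  { intros z Hz. rewrite <- (Hw z Hz). unfold F, zfpf.
    assert (N := Ng z Hz).
    destruct (Req_EM_T (Cmod z) 0) as [Ez|Nz].
    - apply Cmod_eq_0 in Ez. subst z. field. exact N.
    - assert (Nz' : z <> 0%C) by (intros Ez; apply Nz; rewrite Ez; apply Cmod_0).
      assert (D : f' z = (1 * g z + z * g1 z)%C).
      { apply (cderiv_unique f z); [now apply Hf'|].
        apply cderiv_ext_disk with (f := fun y => (y * g y)%C); [exact Hz| |].
        - intros y Hy. symmetry. now apply Eg.
        - apply (cderiv_mult (fun y => y) g); [apply cderiv_id|now apply Dg]. }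
      rewrite D, (Eg z Hz). field. split; assumption. }
  assert (DF : forall z, unit_disk z -> cderiv F z (F1 z)).
  { intros z Hz. replace (F1 z) with (0 + F1 z)%C by ring.
    apply (cderiv_plus (fun _ => RtoC 1) (fun y => y * g1 y / g y)%C); [apply cderiv_const|].
    apply (cderiv_div (fun y => y * g1 y)%C g); [now apply Ng| |now apply Dg].
    apply (cderiv_mult (fun y => y) g1); [apply cderiv_id|now apply Dg1]. }
  assert (CF : forall z, unit_disk z -> ccont F1 z).
  { intros z Hz.
    assert (C0 := cderiv_ccont _ _ _ (Dg z Hz)).
    assert (C1 := cderiv_ccont _ _ _ (Dg1 z Hz)).
    assert (C2 := cderiv_ccont _ _ _ (Dg2 z Hz)).
    assert (N := Ng z Hz).
    apply ccont_mult; [|apply (ccont_inv (fun y => g y * g y)%C);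
      [now apply Cmult_neq_0|now apply ccont_mult]].
    apply ccont_ext with (r := 1)
      (f := fun y => ((g1 y + y * g2 y) * g y + (- RtoC 1) * (y * g1 y * g1 y))%C);
      [lra|intros; ring|].
    apply ccont_plus.
    - apply ccont_mult; [|exact C0]. apply ccont_plus; [exact C1|].
      apply ccont_mult; [apply ccont_id|exact C2].
    - apply ccont_mult; [apply ccont_const|]. apply ccont_mult; [|exact C1].
      apply ccont_mult; [apply ccont_id|exact C1]. }
  (* The chain rule applied to F = phi(w) reads F' = w' (1 + w). Solving for w' exhibits it as a
     quotient of continuous functions. *)
  set (w' := fun z => (F1 z / (1 + w z))%C).
  assert (Nw : forall z, unit_disk z -> (1 + w z)%C <> 0%C)
    by (intros z Hz; apply one_plus_neq0; now apply Bw).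
  assert (Dw : forall z, unit_disk z -> cderiv w z (w' z)).
  { intros z Hz. destruct (Aw z Hz) as [l Hl].
    assert (E : (l * (1 + w z))%C = F1 z).
    { apply (cderiv_unique F z); [|now apply DF].
      apply cderiv_ext_disk with (f := fun y => phi_car (w y)); [exact Hz| |].
      - intros y Hy. symmetry. now apply EF.
      - apply (cderiv_comp w phi_car); [exact Hl|apply cderiv_phi_car]. }
    replace (w' z) with l; [exact Hl|]. unfold w'. rewrite <- E. field. now apply Nw. }
  replace (a 2%nat) with (w' 0%C).
  - apply (Schwarz_derivative w w'); [exact Dw| |exact Bw|exact W0].
    intros z Hz. apply ccont_mult; [now apply CF|].
    apply (ccont_inv (fun y => 1 + w y)%C); [now apply Nw|].
    apply ccont_plus; [apply ccont_const|]. apply (cderiv_ccont _ _ _ (Dw z Hz)).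
  - unfold w', F1. rewrite W0, G0, G1. field.
Qed.

(** * Squares of discs *)

Lemma Cmod_sqr (z : C) : Cmod z * Cmod z = fst z * fst z + snd z * snd z.
Proof.
  unfold Cmod. rewrite sqrt_sqrt; [simpl; ring|].
  apply Rplus_le_le_0_compat; apply pow2_ge_0.
Qed.

Lemma Cmod_lt_sqr (z : C) (r : R) :
  0 <= r -> (Cmod z < r <-> fst z * fst z + snd z * snd z < r * r).
Proof.
  intros Hr. rewrite <- Cmod_sqr. assert (P := Cmod_ge_0 z). split; intros H; nra.
Qed.

(** With m = |P| and x = Re P, the root has real part sqrt((m + x)/2) and imaginary part sqrt((m -
    x)/2) up to a sign, which must match that of Im P. The right half-plane selects the root that
    can be close to 1. *)
Lemma csqrt_exists (P : C) : exists p : C, (p * p)%C = P /\ 0 <= fst p.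
Proof.
  assert (M := Cmod_sqr P). assert (M0 := Cmod_ge_0 P). assert (M1 := fst_le_Cmod P).
  destruct P as [x y]. simpl in M, M1. set (m := Cmod (x, y)) in *.
  apply Rabs_le_between in M1.
  assert (X := sqrt_sqrt ((m + x) / 2) ltac:(lra)).
  assert (Y := sqrt_sqrt ((m - x) / 2) ltac:(lra)).
  assert (X0 := sqrt_pos ((m + x) / 2)). assert (Y0 := sqrt_pos ((m - x) / 2)).
  set (s := sqrt ((m + x) / 2)) in *. set (r := sqrt ((m - x) / 2)) in *.
  assert (Q : (2 * s * r) * (2 * s * r) = y * y).
  { replace (2 * s * r * (2 * s * r)) with (4 * (s * s) * (r * r)) by ring.
    rewrite X, Y. nra. }
  assert (Z : (2 * s * r - y) * (2 * s * r + y) = 0) by nra.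
  apply Rmult_integral in Z. destruct Z as [Z|Z].
  - exists (s, r). split; [|exact X0]. unfold Cmult. simpl. f_equal; lra.
  - exists (s, - r). split; [|exact X0]. unfold Cmult. simpl. f_equal; lra.
Qed.

(* For k = v'/v the relation reads v (k^2 - t) = 2 (t - k), whence
   Re((1 + k v) |k^2 - t|^2) = (|k|^2 - t) (2 t Re k - |k|^2 - t),
   which is negative if |k| > 1. *)
Lemma square_starlike (v v' : C) (t : R) :
  0 <= t <= 1 ->
  ((1 + v') * (1 + v') = RtoC (1 - t) + RtoC t * ((1 + v) * (1 + v)))%C ->
  0 <= fst (1 + v')%C -> Cmod v' <= Cmod v.
Proof.
  intros Ht E Re0. apply Rnot_lt_le. intros L.
  destruct (Req_EM_T (Cmod v) 0) as [E0|N0].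
  - apply Cmod_eq_0 in E0. subst v.
    (* For v = 0 no ratio k exists; the relation degenerates to v' (2 + v') = 0, and Re(2 + v') >= 1
       leaves v' = 0. *)
    assert (Z : (v' * (2 + v'))%C = 0%C).
    { replace (v' * (2 + v'))%C with ((1 + v') * (1 + v') - 1)%C by (ring).
      rewrite E, RtoC_minus. ring. }
    assert (A : 0 < Cmod (2 + v')).
    { eapply Rlt_le_trans; [|apply fst_le_Cmod]. simpl in *.
      eapply Rlt_le_trans; [|apply Rle_abs]. lra. }
    assert (Z' := Cmod_mult v' (2 + v')). rewrite Z, Cmod_0 in *. nra.
  - assert (Nv : v <> 0%C) by (intros Ev; apply N0; rewrite Ev; apply Cmod_0).
    set (k := (v' / v)%C).
    assert (Ek : v' = (k * v)%C) by (unfold k; field; exact Nv).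
    clearbody k.
    assert (K1 : 1 < Cmod k).
    { rewrite Ek, Cmod_mult in L. assert (P := proj1 (Cmod_gt_0 v) Nv). nra. }
    assert (Q : (v * (k * k - RtoC t) = 2 * (RtoC t - k))%C).
    { assert (R0 : (v * (v * (k * k - RtoC t) - 2 * (RtoC t - k)))%C = 0%C).
      { transitivity ((1 + v') * (1 + v') - (RtoC (1 - t) + RtoC t * ((1 + v) * (1 + v))))%C.
        - rewrite Ek, RtoC_minus. ring.
        - rewrite E. ring. }
      apply Cmod_sub_eq0.
      assert (M := Cmod_mult v (v * (k * k - RtoC t) - 2 * (RtoC t - k))).
      rewrite R0, Cmod_0 in M. symmetry in M. apply Rmult_integral in M.
      destruct M; [contradiction|assumption]. }
    assert (Km := Cmod_sqr k).
    rewrite Ek in Re0. clear Ek L E N0 Nv.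
    destruct v as [p q]. destruct k as [x y]. simpl in Re0, Km.
    assert (Q1 := f_equal fst Q). assert (Q2 := f_equal snd Q). simpl in Q1, Q2.
    assert (KK : 1 < x * x + y * y) by nra.
    set (X := x * x - y * y - t). set (Y := 2 * (x * y)).
    assert (R1 : p * X - q * Y = 2 * (t - x)) by (unfold X, Y; lra).
    assert (R2 : p * Y + q * X = - 2 * y) by (unfold X, Y; lra).
    assert (D : (1 + x * p - y * q) * (X * X + Y * Y)
      = (x * x + y * y - t) * (2 * t * x - (x * x + y * y) - t)).
    { replace ((1 + x * p - y * q) * (X * X + Y * Y)) with
        (X * X + Y * Y + x * (X * (p * X - q * Y) + Y * (p * Y + q * X))
         - y * (X * (p * Y + q * X) - Y * (p * X - q * Y))) by ring.
      rewrite R1, R2. unfold X, Y. ring. }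
    assert (N1 : 0 <= (1 + x * p - y * q) * (X * X + Y * Y)).
    { apply Rmult_le_pos; [lra|nra]. }
    (* As 2x < |k|^2 + 1 for k <> 1, the left side is at most -(1 - t) |k|^2, strictly below it if t
       > 0; for t = 0 it equals -|k|^2. *)
    assert (N2 : 2 * t * x - (x * x + y * y) - t < 0).
    { assert (0 <= (x - 1) * (x - 1) + y * y) by nra.
      assert (t * (2 * x) <= t * (x * x + y * y + 1)) by (apply Rmult_le_compat_l; lra).
      assert (0 <= (1 - t) * (x * x + y * y - 1)) by (apply Rmult_le_pos; lra).
      destruct (Req_EM_T t 0) as [T|T]; [subst t; lra|].
      assert (t * (2 * x) < t * (x * x + y * y + 1)).
      { apply Rmult_lt_compat_l; [lra|].
        destruct (Req_EM_T x 1) as [Hx|Hx]; [subst x; lra|].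
        assert (0 < (x - 1) * (x - 1)) by nra. nra. }
      lra. }
    nra.
Qed.

(** With m = |p|^2 the left condition says m + 1 - r^2 < 2 Re p. Both sides are nonnegative, so
    squaring is an equivalence, and (2 Re p)^2 = 2 m + 2 Re(p^2) leaves only |p^2| and Re(p^2). *)
Lemma square_disc (p : C) (r : R) :
  0 <= r <= 1 -> 0 <= fst p ->
  (Cmod (p - 1) < r <->
   (Cmod (p * p) - r * r) * (Cmod (p * p) - r * r) < 2 * fst (p * p)%C - 1 + 2 * (r * r)).
Proof.
  intros Hr Hp. rewrite Cmod_lt_sqr, Cmod_mult, Cmod_sqr by lra.
  destruct p as [x y]. simpl in *.
  set (m := x * x + y * y).
  replace ((x + - (1)) * (x + - (1)) + (y + - 0) * (y + - 0)) with (m + 1 - 2 * x)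
    by (unfold m; ring).
  assert (K : (m - r * r) * (m - r * r) - (2 * (x * x - y * y) - 1 + 2 * (r * r))
    = (m + 1 - r * r) * (m + 1 - r * r) - (2 * x) * (2 * x)) by (unfold m; ring).
  assert (0 <= m) by (unfold m; nra). assert (r * r <= 1) by nra.
  split; intros H'; nra.
Qed.

(* The disc condition becomes a convex one in P = p^2: (|P| - r^2)^2 < 2 Re P - 1 + 2 r^2,
   since |P| >= Re P >= 1/2 - r^2 >= r^2 for r <= 1/2. *)
Lemma square_convex (p1 p2 p : C) (r t : R) :
  0 < r <= 1 / 2 -> 0 <= t <= 1 -> 0 <= fst p ->
  Cmod (p1 - 1) < r -> Cmod (p2 - 1) < r ->
  (p * p = RtoC (1 - t) * (p1 * p1) + RtoC t * (p2 * p2))%C -> Cmod (p - 1) < r.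
Proof.
  intros Hr Ht Hp H1 H2 E.
  assert (F : forall q : C, Cmod (q - 1) < r -> 0 <= fst q).
  { intros q Hq. assert (X := fst_le_Cmod (q - 1)%C).
    assert (Y : Rabs (fst q - 1) < r) by exact (Rle_lt_trans _ _ _ X Hq).
    apply Rabs_lt_between in Y. lra. }
  apply square_disc in H1; [|lra|now apply F]. apply square_disc in H2; [|lra|now apply F].
  apply square_disc; [lra|exact Hp|].
  assert (T : Cmod (p * p) <= (1 - t) * Cmod (p1 * p1) + t * Cmod (p2 * p2)).
  { rewrite E. eapply Rle_trans; [apply Cmod_triangle|].
    rewrite !(Cmod_mult (RtoC _)), !Cmod_RtoC_pos by lra. lra. }
  assert (G : fst (p * p)%C = (1 - t) * fst (p1 * p1)%C + t * fst (p2 * p2)%C).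
  { rewrite E. simpl. ring. }
  assert (L := fst_le_Cmod (p * p)%C). assert (L' := Rle_abs (fst (p * p)%C)).
  set (m := Cmod (p * p)) in *. set (m1 := Cmod (p1 * p1)) in *.
  set (m2 := Cmod (p2 * p2)) in *. set (R0 := fst (p * p)%C) in *.
  set (R1 := fst (p1 * p1)%C) in *. set (R2 := fst (p2 * p2)%C) in *.
  assert (Rr : r * r <= 1 / 4) by nra.
  assert (S1 := Rle_0_sqr (m1 - r * r)). assert (S2 := Rle_0_sqr (m2 - r * r)).
  unfold Rsqr in S1, S2.
  assert (A1 : 1 / 4 <= R1) by lra. assert (A2 : 1 / 4 <= R2) by lra.
  assert (A0 : 1 / 4 <= R0).
  { assert (0 <= (1 - t) * (R1 - 1 / 4)) by (apply Rmult_le_pos; lra).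
    assert (0 <= t * (R2 - 1 / 4)) by (apply Rmult_le_pos; lra). lra. }
  set (M := (1 - t) * m1 + t * m2) in *.
  assert (B : (m - r * r) * (m - r * r) <= (M - r * r) * (M - r * r)).
  { apply Rmult_le_compat; lra. }
  assert (J : (M - r * r) * (M - r * r) <=
    (1 - t) * ((m1 - r * r) * (m1 - r * r)) + t * ((m2 - r * r) * (m2 - r * r))).
  { apply Rminus_le_0.
    replace (_ - _) with ((1 - t) * t * ((m1 - m2) * (m1 - m2))) by (unfold M; ring).
    apply Rmult_le_pos; [apply Rmult_le_pos; lra|apply Rle_0_sqr]. }
  rewrite G. destruct (Req_EM_T t 0) as [T0|T0].
  - subst t. lra.
  - assert (t * ((m2 - r * r) * (m2 - r * r)) < t * (2 * R2 - 1 + 2 * (r * r)))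
      by (apply Rmult_lt_compat_l; lra).
    assert ((1 - t) * ((m1 - r * r) * (m1 - r * r)) <= (1 - t) * (2 * R1 - 1 + 2 * (r * r)))
      by (apply Rmult_le_compat_l; lra).
    lra.
Qed.

(** * Quadratic polynomials *)

Lemma RtoC_neq0 (x : R) : x <> 0 -> RtoC x <> 0%C.
Proof. intros H E. apply H. now apply RtoC_inj. Qed.

Lemma Cmod_mult_le (b z : C) : Cmod b <= 1 -> Cmod (b * z) <= Cmod z.
Proof. intros H. rewrite Cmod_mult. assert (P := Cmod_ge_0 z). nra. Qed.

(** The difference of the two values is (z1 - z2)(1 + b (z1 + z2)), and |b (z1 + z2)| < 1. *)
Lemma quadratic_injective (b z1 z2 : C) :
  Cmod b <= 1 -> disk (1 / 2) z1 -> disk (1 / 2) z2 ->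
  (z1 + b * (z1 * z1) = z2 + b * (z2 * z2))%C -> z1 = z2.
Proof.
  unfold disk. intros Hb H1 H2 E. apply Cmod_sub_eq0.
  assert (Z : ((z1 - z2) * (1 + b * (z1 + z2)))%C = 0%C).
  { replace ((z1 - z2) * (1 + b * (z1 + z2)))%C
      with ((z1 + b * (z1 * z1)) - (z2 + b * (z2 * z2)))%C by ring.
    rewrite E. ring. }
  assert (N : (1 + b * (z1 + z2))%C <> 0%C).
  { apply one_plus_neq0. eapply Rle_lt_trans; [now apply Cmod_mult_le|].
    eapply Rle_lt_trans; [apply Cmod_triangle|lra]. }
  apply Cmod_gt_0 in N. assert (M := Cmod_mult (z1 - z2) (1 + b * (z1 + z2))).
  rewrite Z, Cmod_0 in M. symmetry in M. apply Rmult_integral in M. destruct M; lra.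
Qed.

Lemma quadratic_of_square (b z' p : C) :
  b <> 0%C -> z' = ((p - 1) / (2 * b))%C ->
  (z' + b * (z' * z') = (p * p - 1) / (4 * b))%C.
Proof. intros Nb ->. field. exact Nb. Qed.

Lemma Cmod_double (z b : C) : Cmod (2 * b * z) = 2 * Cmod b * Cmod z.
Proof. now rewrite !Cmod_mult, (Cmod_RtoC_pos 2) by lra. Qed.

Lemma quadratic_starlike (a : nat -> C) :
  Cmod (a 2%nat) <= 1 -> starlike_in (partial2 a) (1 / 2).
Proof.
  unfold partial2. set (b := a 2%nat). intros Hb. split.
  - intros z1 z2. now apply quadratic_injective.
  - intros z t Hz Ht. unfold disk in *.
    destruct (Req_EM_T (Cmod b) 0) as [E|N].
    + apply Cmod_eq_0 in E. rewrite E. exists (RtoC t * z)%C. split; [|ring].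
      rewrite Cmod_mult, Cmod_RtoC_pos by lra. assert (P := Cmod_ge_0 z). nra.
    + assert (Nb : b <> 0%C) by (intros E; apply N; rewrite E; apply Cmod_0).
      set (v := (2 * b * z)%C).
      (* Since 4 b f_2(z) = (1 + v)^2 - 1, a preimage z' of t f_2(z) must satisfy (1 + 2 b z')^2 =
         (1 - t) + t (1 + v)^2; the root in the right half-plane gives |z'| <= |z|. *)
      destruct (csqrt_exists (RtoC (1 - t) + RtoC t * ((1 + v) * (1 + v)))%C) as [p [Ep Pp]].
      exists ((p - 1) / (2 * b))%C. split.
      * assert (S : Cmod (p - 1) <= Cmod v).
        { apply (square_starlike v (p - 1)%C t Ht);
            replace (1 + (p - 1))%C with p by ring; assumption. }
        assert (P := proj1 (Cmod_gt_0 b) Nb).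
        assert (N2 : (2 * b)%C <> 0%C) by (apply Cmult_neq_0; [apply RtoC_neq0; lra|exact Nb]).
        rewrite Cmod_div by exact N2. rewrite Cmod_mult, (Cmod_RtoC_pos 2) by lra.
        unfold v in S. rewrite Cmod_double in S.
        apply Rlt_div_l; [lra|]. nra.
      * rewrite (quadratic_of_square b _ p Nb eq_refl), Ep, RtoC_minus.
        unfold v. field. exact Nb.
Qed.

Lemma quadratic_convex (a : nat -> C) :
  Cmod (a 2%nat) <= 1 -> convex_in (partial2 a) (1 / 4).
Proof.
  unfold partial2. set (b := a 2%nat). intros Hb. split.
  - intros z1 z2 H1 H2. apply quadratic_injective; unfold disk in *; lra.
  - intros z1 z2 t H1 H2 Ht. unfold disk in *.
    destruct (Req_EM_T (Cmod b) 0) as [E|N].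
    + apply Cmod_eq_0 in E. rewrite E. exists (RtoC (1 - t) * z1 + RtoC t * z2)%C.
      split; [|ring].
      eapply Rle_lt_trans; [apply Cmod_triangle|].
      rewrite !Cmod_mult, !Cmod_RtoC_pos by lra.
      destruct (Req_EM_T t 0) as [T|T]; [subst t; lra|].
      assert (t * Cmod z2 < t * (1 / 4)) by (apply Rmult_lt_compat_l; lra).
      assert ((1 - t) * Cmod z1 <= (1 - t) * (1 / 4)) by (apply Rmult_le_compat_l; lra).
      lra.
    + assert (Nb : b <> 0%C) by (intros E; apply N; rewrite E; apply Cmod_0).
      assert (P := proj1 (Cmod_gt_0 b) Nb).
      set (p1 := (1 + 2 * b * z1)%C). set (p2 := (1 + 2 * b * z2)%C).
      destruct (csqrt_exists (RtoC (1 - t) * (p1 * p1) + RtoC t * (p2 * p2))%C) as [p [Ep Pp]].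
      exists ((p - 1) / (2 * b))%C. split.
      (* Radius 1/4 for z becomes radius |b|/2 <= 1/2 for p = 1 + 2 b z, the range covered by
         [square_convex]. *)
      * assert (S : Cmod (p - 1) < Cmod b / 2).
        { apply (square_convex p1 p2 p (Cmod b / 2) t); try assumption; try lra.
          - unfold p1. replace (1 + 2 * b * z1 - 1)%C with (2 * b * z1)%C by ring.
            rewrite Cmod_double. nra.
          - unfold p2. replace (1 + 2 * b * z2 - 1)%C with (2 * b * z2)%C by ring.
            rewrite Cmod_double. nra. }
        assert (N2 : (2 * b)%C <> 0%C) by (apply Cmult_neq_0; [apply RtoC_neq0; lra|exact Nb]).
        rewrite Cmod_div by exact N2. rewrite Cmod_mult, (Cmod_RtoC_pos 2) by lra.
        apply Rlt_div_l; lra.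
      * rewrite (quadratic_of_square b _ p Nb eq_refl), Ep, RtoC_minus.
        unfold p1, p2. field. exact Nb.
Qed.

(** [sq] is an arbitrary selection of roots with nonnegative real part. Its continuity at P follows
    from sq Q - sq P = (Q - P)/(sq Q + sq P), whose denominator has modulus at least Re(sq P) > 0;
    the same identity is the slope. *)
Lemma cderiv_csqrt (sq : C -> C) (P : C) :
  (forall Q, (sq Q * sq Q)%C = Q /\ 0 <= fst (sq Q)) -> 0 < fst P ->
  cderiv sq P (/ (sq P + sq P))%C.
Proof.
  intros Hsq HP. destruct (Hsq P) as [E0 R0].
  assert (X : 0 < fst (sq P)).
  { rewrite <- E0 in HP. simpl in HP. nra. }
  assert (L : forall Q, fst (sq P) <= Cmod (sq Q + sq P)).
  { intros Q. destruct (Hsq Q) as [_ R1].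
    assert (Y := fst_le_Cmod (sq Q + sq P)%C). assert (Y' := Rle_abs (fst (sq Q + sq P)%C)).
    simpl in Y'. simpl fst in Y. lra. }
  assert (NZ : forall Q, (sq Q + sq P)%C <> 0%C) by (intros Q; apply Cmod_gt_0; specialize (L Q); lra).
  assert (F : forall Q, (sq Q - sq P)%C = ((Q - P) * / (sq Q + sq P))%C).
  { intros Q. destruct (Hsq Q) as [E1 _]. rewrite <- E1 at 2. rewrite <- E0 at 2.
    field. apply NZ. }
  assert (Cs : ccont sq P).
  { intros e He. exists (e * fst (sq P)). split; [now apply Rmult_lt_0_compat|].
    intros Q HQ. rewrite F, Cmod_mult, Cmod_inv by apply NZ.
    specialize (L Q). apply Rlt_div_l; [lra|].
    eapply Rlt_le_trans; [exact HQ|]. apply Rmult_le_compat_l; lra. }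
  apply cderiv_slope. exists (fun Q => / (sq Q + sq P))%C. split; [|split].
  - intros Q. rewrite <- F. ring.
  - reflexivity.
  - apply (ccont_inv (fun Q => sq Q + sq P)%C); [apply NZ|].
    apply ccont_plus; [exact Cs|apply ccont_const].
Qed.

Lemma cderiv_quadratic (b z : C) : cderiv (fun y => (y + b * (y * y))%C) z (1 + 2 * b * z)%C.
Proof.
  replace (1 + 2 * b * z)%C with (1 + (0 * (z * z) + b * (1 * z + z * 1)))%C by ring.
  apply (cderiv_plus (fun y => y) (fun y => b * (y * y))%C); [apply cderiv_id|].
  apply (cderiv_mult (fun _ => b) (fun y => y * y)%C); [apply cderiv_const|].
  apply (cderiv_mult (fun y => y) (fun y => y)); apply cderiv_id.
Qed.

Lemma cderiv_one_plus_linear (c z : C) : cderiv (fun y => (1 + c * y)%C) z c.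
Proof.
  assert (X : cderiv (fun y => (1 + c * y)%C) z (0 + (0 * z + c * 1))%C);
    [|replace (0 + (0 * z + c * 1))%C with c in X by ring; exact X].
  apply (cderiv_plus (fun _ => RtoC 1) (fun y => c * y)%C); [apply cderiv_const|].
  apply (cderiv_mult (fun _ => c) (fun y => y)); [apply cderiv_const|apply cderiv_id].
Qed.

Lemma quadratic_S_car (b : C) : Cmod b <= 1 / 3 -> S_car (fun z => (z + b * (z * z))%C).
Proof.
  intros Hb.
  assert (Hbz : forall z, unit_disk z -> Cmod (b * z) < 1 / 3).
  { unfold unit_disk, disk. intros z Hz. rewrite Cmod_mult.
    assert (P := Cmod_ge_0 z). assert (P' := Cmod_ge_0 b).
    destruct (Req_EM_T (Cmod b) 0) as [E|E]; [rewrite E; lra|]. nra. }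
  assert (Nd : forall z, unit_disk z -> (1 + b * z)%C <> 0%C).
  { intros z Hz. apply one_plus_neq0. specialize (Hbz z Hz). lra. }
  split; [split; [|split]|].
  - intros z _. eexists. apply cderiv_quadratic.
  - ring.
  - replace (RtoC 1) with (1 + 2 * b * 0)%C by ring. apply cderiv_quadratic.
  - exists (fun z => 1 + 2 * b * z)%C. split; [intros z _; apply cderiv_quadratic|]. split.
    { intros z Hz Nz. replace (z + b * (z * z))%C with (z * (1 + b * z))%C by ring.
      apply Cmult_neq_0; auto. }
    destruct (functional_choice _ csqrt_exists) as [sq Hsq].
    (* As phi(w) = (1 + (1 + w)^2)/2, the function to be squared away is P = 2 z f'/f - 1 = (1 +
       w)^2. *)
    set (P := fun z => ((1 + 3 * b * z) / (1 + b * z))%C).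
    (* The condition is 2 |b z| < |1 + b z|; the constant 1/3 is the solution of 2x = 1 - x. *)
    assert (HP : forall z, unit_disk z -> Cmod (P z - 1) < 1).
    { intros z Hz. specialize (Hbz z Hz). assert (N := Nd z Hz).
      replace (P z - 1)%C with (2 * (b * z) / (1 + b * z))%C by (unfold P; field; exact N).
      rewrite Cmod_div by exact N. rewrite Cmod_mult, (Cmod_RtoC_pos 2) by lra.
      apply Rlt_div_l; [now apply Cmod_gt_0|].
      assert (T := Cmod_le_sub 1 (1 + b * z)).
      rewrite Cmod_sub_sym in T. replace (1 + b * z - 1)%C with (b * z)%C in T by ring.
      rewrite Cmod_1 in T. lra. }
    assert (RP : forall z, unit_disk z -> 0 < fst (P z)).
    { intros z Hz. assert (X := Rle_lt_trans _ _ _ (fst_le_Cmod (P z - 1)%C) (HP z Hz)).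
      change (Rabs (fst (P z) - 1) < 1) in X. apply Rabs_lt_between in X. lra. }
    (* For p = sq (P z), |p - 1| |p + 1| = |P - 1| and Re p >= 0 gives |p + 1| >= 1. This yields
       both |w| < 1 and, from P(0) = 1, w(0) = 0. *)
    assert (Hw : forall z, Cmod (sq (P z) - 1) <= Cmod (P z - 1)).
    { intros z. destruct (Hsq (P z)) as [E R0].
      replace (Cmod (P z - 1)) with (Cmod (sq (P z) - 1) * Cmod (sq (P z) + 1)).
      2:{ rewrite <- Cmod_mult. f_equal. rewrite <- E at 3. ring. }
      assert (X := fst_le_Cmod (sq (P z) + 1)%C).
      assert (X' : fst (sq (P z)) + 1 <= Rabs (fst (sq (P z) + 1)%C)) by apply Rle_abs.
      assert (Y := Cmod_ge_0 (sq (P z) - 1)%C). nra. }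
    exists (fun z => (sq (P z) + - (1))%C). split; [|split; [|split]].
    + intros z Hz. eexists.
      apply (cderiv_plus (fun z => sq (P z)) (fun _ => (- (1))%C)); [|apply cderiv_const].
      apply (cderiv_comp P sq).
      * apply (cderiv_div (fun z => 1 + 3 * b * z)%C (fun z => 1 + b * z)%C);
          [now apply Nd|apply cderiv_one_plus_linear|apply cderiv_one_plus_linear].
      * apply cderiv_csqrt; [exact Hsq|now apply RP].
    + intros z Hz. eapply Rle_lt_trans; [apply Hw|now apply HP].
    + apply Cmod_eq_0. apply Rle_antisym; [|apply Cmod_ge_0].
      eapply Rle_trans; [apply Hw|]. right.
      replace (P 0 - 1)%C with (RtoC 0); [apply Cmod_0|].
      unfold P. field.
    + intros z Hz. unfold phi_car.
      replace (1 + (sq (P z) + - (1)) + (sq (P z) + - (1)) * (sq (P z) + - (1)) / 2)%C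
        with ((1 + sq (P z) * sq (P z)) / 2)%C by field.
      rewrite (proj1 (Hsq (P z))). unfold zfpf.
      destruct (Req_EM_T (Cmod z) 0) as [E|N].
      * apply Cmod_eq_0 in E. subst z. unfold P. field.
      * assert (Nz : z <> 0%C) by (intros E; apply N; rewrite E; apply Cmod_0).
        unfold P. assert (X := Nd z Hz).
        replace (z + b * (z * z))%C with (z * (1 + b * z))%C by ring.
        field. split; assumption.
Qed.

Lemma partial2_rescale (a : nat -> C) (rho : R) (z : C) :
  rho <> 0 ->
  (partial2 a (RtoC rho * z) / RtoC rho)%C = (z + (a 2%nat * RtoC rho) * (z * z))%C.
Proof. intros H. unfold partial2. field. now apply RtoC_neq0. Qed.

Lemma partial2_rescale_S_car (a : nat -> C) (rho : R) :
  Cmod (a 2%nat) <= 1 -> 0 < rho <= 1 / 3 ->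
  S_car (fun z => (partial2 a (RtoC rho * z) / RtoC rho)%C).
Proof.
  intros Ha Hr.
  replace (fun z => (partial2 a (RtoC rho * z) / RtoC rho)%C)
    with (fun z => (z + (a 2%nat * RtoC rho) * (z * z))%C).
  - apply quadratic_S_car. rewrite Cmod_mult, Cmod_RtoC_pos by lra. nra.
  - apply functional_extensionality. intros z. symmetry. apply partial2_rescale. lra.
Qed.

(** * Sharpness *)

(* Pairs of consecutive Taylor coefficients of exp (c (z + z^2/4)), which solves
   G' = c (1 + z/2) G, i.e. (n+1) e_(n+1) = c (e_n + e_(n-1)/2). *)
Fixpoint exp_coeff_pair (c : R) (n : nat) : R * R :=
  match n with
  | O => (1, 0)
  | S m => let (x, y) := exp_coeff_pair c m in (c * (x + y / 2) / INR (S m), x)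
  end.

Definition exp_coeff (c : R) (n : nat) : R := fst (exp_coeff_pair c n).

Lemma exp_coeff_1 (c : R) : exp_coeff c 1 = c.
Proof. unfold exp_coeff. simpl. field. Qed.

Lemma exp_coeff_rec (c : R) (n : nat) :
  INR (S (S n)) * exp_coeff c (S (S n)) = c * (exp_coeff c (S n) + exp_coeff c n / 2).
Proof.
  unfold exp_coeff. change (exp_coeff_pair c (S (S n))) with
    (let (x, y) := exp_coeff_pair c (S n) in (c * (x + y / 2) / INR (S (S n)), x)).
  assert (E : snd (exp_coeff_pair c (S n)) = fst (exp_coeff_pair c n)).
  { simpl. destruct (exp_coeff_pair c n). reflexivity. }
  rewrite <- E. destruct (exp_coeff_pair c (S n)) as [x y]. unfold fst, snd.
  field. apply not_0_INR. lia.
Qed.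

(** A crude bound, but bounded coefficients already give convergence on the unit disc by comparison
    with the geometric series. The recursion has depth two, so the induction carries two consecutive
    terms. *)
Lemma exp_coeff_bound (c : R) (n : nat) : Rabs c <= 1 -> Rabs (exp_coeff c n) <= 1.
Proof.
  intros Hc.
  assert (H : Rabs (exp_coeff c n) <= 1 /\ Rabs (exp_coeff c (S n)) <= 1); [|apply H].
  induction n as [|n [IH1 IH2]].
  - split; [|now rewrite exp_coeff_1].
    unfold exp_coeff. simpl. rewrite Rabs_R1. lra.
  - split; [exact IH2|].
    assert (P : 2 <= INR (S (S n))) by (rewrite !S_INR; assert (Q := pos_INR n); lra).
    assert (E := f_equal Rabs (exp_coeff_rec c n)). rewrite !Rabs_mult in E.
    rewrite (Rabs_pos_eq (INR _)) in E by lra.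
    assert (T : Rabs (exp_coeff c (S n) + exp_coeff c n / 2) <= 2).
    { eapply Rle_trans; [apply Rabs_triang|]. unfold Rdiv. rewrite Rabs_mult.
      rewrite (Rabs_pos_eq (/ 2)) by lra. lra. }
    assert (Z := Rabs_pos (exp_coeff c (S (S n)))).
    assert (Z1 := Rabs_pos c). assert (Z2 := Rabs_pos (exp_coeff c (S n) + exp_coeff c n / 2)).
    nra.
Qed.

(** The differential equation is checked coefficient by coefficient through the recursion. The
    parameter is there for c = 1 and c = -1, whose solutions are reciprocal to each other. *)
Lemma exp_series (c : R) : Rabs c <= 1 ->
  exists G : C -> C, taylor_coeffs G (fun n => RtoC (exp_coeff c n)) /\
    G 0%C = 1%C /\
    forall z, unit_disk z -> cderiv G z (RtoC c * (1 + z / 2) * G z)%C.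
Proof.
  intros Hc.
  assert (Ex : forall z, exists l, unit_disk z ->
    @is_pseries C_AbsRing C_NormedModule (fun n => RtoC (exp_coeff c n)) z l).
  { intros z. destruct (Rlt_dec (Cmod z) 1) as [D|D]; [|exists (RtoC 0); intros; contradiction].
    destruct (cseries_exists (fun n => RtoC (exp_coeff c n) * z ^ n)%C
      (fun n => Cmod z ^ n)) as [l Hl].
    - intros n. rewrite Cmod_mult, Cmod_pow, Cmod_R.
      assert (X := exp_coeff_bound c n Hc). assert (Y := pow_le (Cmod z) n (Cmod_ge_0 z)).
      nra.
    - apply ex_series_geom. rewrite Rabs_pos_eq by apply Cmod_ge_0. exact D.
    - exists l. intros _. now apply is_cpseries. }
  destruct (functional_choice _ Ex) as [G HG]. change (C -> C) in G.
  exists G. split; [exact HG|]. split; [exact (taylor_coeffs_0 _ _ HG)|].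
  destruct (cpseries_derive G _ HG) as [G1 [HG1 DG]].
  intros z Hz. replace (RtoC c * (1 + z / 2) * G z)%C with (G1 z); [now apply DG|].
  assert (S1 := HG1 z Hz). assert (S0 := HG z Hz). apply is_cpseries in S1, S0.
  apply (cseries_unique _ _ _ S1).
  replace (RtoC c * (1 + z / 2) * G z)%C
    with (RtoC c * G z + RtoC c * (z / 2) * G z)%C by (unfold Cdiv; ring).
  assert (S2 := cseries_scal (RtoC c) _ _ S0).
  (* Multiplication by z/2 shifts the coefficients by one place, which brings in a zero constant
     term. *)
  assert (S3 : cseries (fun n => match n with O => 0 | S m =>
    RtoC c * (z / 2) * (RtoC (exp_coeff c m) * z ^ m) end)%C (RtoC c * (z / 2) * G z)%C).
  { apply cseries_tail.
    replace (RtoC c * (z / 2) * G z - 0)%C with (RtoC c * (z / 2) * G z)%C by ring.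
    apply (cseries_scal (RtoC c * (z / 2))%C _ _ S0). }
  eapply cseries_ext; [|apply (cseries_plus _ _ _ _ S2 S3)].
  intros [|n]; unfold cps_derive.
  - rewrite exp_coeff_1. unfold exp_coeff. simpl. ring.
  - rewrite <- RtoC_mult, exp_coeff_rec, RtoC_mult, RtoC_plus, RtoC_div by lra.
    rewrite Cpow_S. field.
Qed.

(** Along the segment from 0 to z, which stays in the disc, both components of H have derivative
    zero. *)
Lemma cderiv_zero_const (H : C -> C) :
  (forall z, unit_disk z -> cderiv H z 0%C) -> forall z, unit_disk z -> H z = H 0%C.
Proof.
  intros D z Hz. unfold unit_disk, disk in *.
  assert (X : forall t, 0 <= t <= 1 -> rderiv (fun s => H (RtoC s * z)%C) t 0%C).
  { intros t Ht. replace (RtoC 0) with (z * 0)%C by ring.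
    apply (rderiv_comp H (fun s => RtoC s * z)%C).
    - apply D. rewrite Cmod_mult, Cmod_RtoC_pos by lra. assert (P := Cmod_ge_0 z). nra.
    - intros e He. exists 1. split; [lra|]. intros s _.
      replace (RtoC s * z - RtoC t * z - RtoC (s - t) * z)%C with (RtoC 0)
        by (rewrite RtoC_minus; ring).
      rewrite Cmod_0. apply Rmult_le_pos; [lra|apply Rabs_pos]. }
  assert (E : H (RtoC 0 * z)%C = H (RtoC 1 * z)%C).
  { apply injective_projections.
    - apply (eq_is_derive (fun s => fst (H (RtoC s * z)%C)) 0 1); [|lra].
      intros t Ht. destruct (proj1 (rderiv_components _ _ _) (X t Ht)) as [X1 X2].
      exact X1.
    - apply (eq_is_derive (fun s => snd (H (RtoC s * z)%C)) 0 1); [|lra].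
      intros t Ht. destruct (proj1 (rderiv_components _ _ _) (X t Ht)) as [X1 X2].
      exact X2. }
  rewrite Cmult_0_l, Cmult_1_l in E. now symmetry.
Qed.

(* f(z) = z exp (z + z^2/4), for which z f'/f = 1 + z + z^2/2 and a_2 = 1. *)
Lemma extremal_function :
  exists (f : C -> C) (a : nat -> C),
    taylor_coeffs f a /\ a 0%nat = 0%C /\ a 1%nat = 1%C /\ S_car f /\ a 2%nat = 1%C.
Proof.
  destruct (exp_series 1) as [G [HG [G0 DG]]]; [rewrite Rabs_R1; lra|].
  destruct (exp_series (-1)) as [K [_ [K0 DK]]]; [rewrite Rabs_left; lra|].
  (* The product G K has derivative zero and the value 1 at 0, so it is 1 throughout and G has no
     zeros. *)
  assert (NG : forall z, unit_disk z -> G z <> 0%C).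
  { intros z Hz E.
    assert (X := cderiv_zero_const (fun y => G y * K y)%C).
    assert (Y : (G z * K z = G 0 * K 0)%C).
    { apply X; [|exact Hz]. intros y Hy.
      assert (W := cderiv_mult G K y _ _ (DG y Hy) (DK y Hy)).
      replace (RtoC 0) with
        (RtoC 1 * (1 + y / 2) * G y * K y + G y * (RtoC (-1) * (1 + y / 2) * K y))%C; [exact W|].
      replace (RtoC (-1)) with (- (1))%C by (now rewrite <- RtoC_opp). unfold Cdiv. ring. }
    rewrite E, G0, K0 in Y. apply (RtoC_neq0 1); [lra|].
    replace (RtoC 1) with (1 * 1)%C by ring. rewrite <- Y. ring. }
  exists (fun z => (z * G z)%C).
  exists (fun n => match n with O => RtoC 0 | S m => RtoC (exp_coeff 1 m) end).
  assert (Df : forall z, unit_disk z ->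
    cderiv (fun y => (y * G y)%C) z ((1 + z + z * z / 2) * G z)%C).
  { intros z Hz.
    replace ((1 + z + z * z / 2) * G z)%C
      with (1 * G z + z * (RtoC 1 * (1 + z / 2) * G z))%C by (unfold Cdiv; ring).
    apply (cderiv_mult (fun y => y) G); [apply cderiv_id|now apply DG]. }
  split; [|split; [reflexivity|split; [reflexivity|split]]].
  - intros z Hz. apply is_cpseries. apply cseries_tail.
    replace (z * G z - 0 * z ^ 0)%C with (z * G z)%C by ring.
    assert (S0 := HG z Hz). apply is_cpseries in S0. apply (cseries_scal z) in S0.
    eapply cseries_ext; [|exact S0]. intros n. simpl. ring.
  - split; [split; [|split]|].
    + intros z Hz. eexists. now apply Df.
    + ring.
    + assert (X := Df _ unit_disk0). rewrite G0 in X.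
      replace ((1 + 0 + 0 * 0 / 2) * 1)%C with (RtoC 1) in X by (unfold Cdiv; ring). exact X.
    + exists (fun z => (1 + z + z * z / 2) * G z)%C. split; [exact Df|]. split.
      { intros z Hz Nz. apply Cmult_neq_0; auto. }
      exists (fun z => z). split; [|split; [|split]].
      * intros z _. eexists. apply cderiv_id.
      * auto.
      * reflexivity.
      * intros z Hz. unfold zfpf, phi_car. destruct (Req_EM_T (Cmod z) 0) as [E|N].
        -- apply Cmod_eq_0 in E. subst z. unfold Cdiv. ring.
        -- field. split; [now apply NG|]. intros E. apply N. rewrite E. apply Cmod_0.
  - now rewrite exp_coeff_1.
Qed.

Lemma Cmod_lt_pair (x y r : R) : 0 <= r -> x * x + y * y < r * r -> Cmod (x, y) < r.
Proof. intros Hr H. now apply Cmod_lt_sqr. Qed.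

(** z + z^2 is symmetric about its critical point -1/2; the offset e is half of r - 1/2, so both
    -1/2 + e and -1/2 - e lie in the disc. *)
Lemma not_injective_beyond_half (a : nat -> C) (r : R) :
  a 2%nat = 1%C -> 1 / 2 < r ->
  ~ (forall z1 z2, disk r z1 -> disk r z2 -> partial2 a z1 = partial2 a z2 -> z1 = z2).
Proof.
  intros Ha Hr H. set (e := (r - 1 / 2) / 2).
  assert (X : RtoC (- (1 / 2) + e) = RtoC (- (1 / 2) - e)).
  { assert (D : forall x, - r < x < r -> disk r (RtoC x)).
    { intros x Hx. unfold disk. rewrite Cmod_R. now apply Rabs_def1. }
    apply H; try (apply D; unfold e; lra).
    unfold partial2. rewrite Ha, <- !RtoC_mult, <- !RtoC_plus. f_equal. field. }
  apply RtoC_inj in X. unfold e in X. lra.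
Qed.

(* -1/4 + iy and -1/4 - iy have images with the real midpoint -3/16 - y^2; for y^2 =
   (r - 1/4)(3/4 - r) this is r^2 - r, the infimum (not attained) of the real values of z + z^2 on |z| < r. *)
Lemma not_convex_beyond_quarter (a : nat -> C) (r : R) :
  a 2%nat = 1%C -> 1 / 4 < r -> ~ convex_in (partial2 a) r.
Proof.
  (* For r > 1/2 injectivity already fails. The remaining range r <= 1/2 also makes the radicand
     below nonnegative. *)
  intros Ha Hr [Inj Cv]. destruct (Rlt_dec (1 / 2) r) as [L|L].
  { now apply (not_injective_beyond_half a r Ha L). }
  assert (P : 0 <= (r - 1 / 4) * (3 / 4 - r)) by (apply Rmult_le_pos; lra).
  set (y := sqrt ((r - 1 / 4) * (3 / 4 - r))).
  assert (Y : y * y = (r - 1 / 4) * (3 / 4 - r)) by now apply sqrt_sqrt.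
  assert (D : y * y < r * r - 1 / 16) by (rewrite Y; nra).
  destruct (Cv (- (1 / 4), y) (- (1 / 4), - y) (1 / 2)) as [[u v] [Hz E]].
  - apply Cmod_lt_pair; lra.
  - apply Cmod_lt_pair; lra.
  - lra.
  - unfold disk in Hz. apply Cmod_lt_sqr in Hz; [|lra]. simpl in Hz.
    unfold partial2 in E. rewrite Ha in E.
    assert (E1 := f_equal fst E). assert (E2 := f_equal snd E). simpl in E1, E2.
    assert (V : v * (1 + 2 * u) = 0) by lra.
    assert (U : u + u * u - v * v = r * r - r) by lra.
    (* If v = 0, then u + u^2 - (r^2 - r) = (u + r)(u + 1 - r) is positive for |u| < r <= 1/2. If u
       = -1/2, the point lies outside the disc. *)
    apply Rmult_integral in V. destruct V as [V|V].
    + subst v. assert (- r < u < r) by nra. nra.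
    + assert (u = - (1 / 2)) by lra. subst u. nra.
Qed.

(* At z = -s/rho with 1/3 < s < 1 the quotient z f2'/f2 is a real number below 1/2 = phi(-1),
   while phi(w) = (1 + (1+w)^2)/2 is real and < 1/2 only if Re (1+w) = 0. *)
Lemma not_S_car_beyond_third (a : nat -> C) (rho : R) :
  a 2%nat = 1%C -> 1 / 3 < rho ->
  ~ S_car (fun z => (partial2 a (RtoC rho * z) / RtoC rho)%C).
Proof.
  intros Ha Hr.
  replace (fun z => (partial2 a (RtoC rho * z) / RtoC rho)%C)
    with (fun z => (z + RtoC rho * (z * z))%C).
  2:{ apply functional_extensionality. intros z. rewrite partial2_rescale, Ha by lra. ring. }
  intros [_ [f' [Df [_ [w [_ [Bw [_ Hw]]]]]]]].
  (* The midpoint of 1/3 and min(rho, 1): s > 1/3 pushes the quotient below 1/2, s < 1 keeps its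
     denominator positive, s < rho puts -s/rho in the unit disc. *)
  set (s := (1 / 3 + Rmin rho 1) / 2).
  assert (Hs : 1 / 3 < s < 1 /\ s < rho).
  { unfold s. assert (A := Rmin_l rho 1). assert (B := Rmin_r rho 1).
    assert (1 / 3 < Rmin rho 1) by (apply Rmin_glb_lt; lra). lra. }
  set (x := - s / rho).
  assert (Rx : rho * x = - s) by (unfold x; field; lra).
  assert (Nx : x <> 0) by (intros E; rewrite E in Rx; lra).
  assert (Dx : unit_disk (RtoC x)).
  { unfold unit_disk, disk. rewrite Cmod_R. apply Rabs_def1; nra. }
  assert (Ef : f' (RtoC x) = RtoC (1 - 2 * s)).
  { apply (cderiv_unique (fun z => z + RtoC rho * (z * z))%C (RtoC x)); [now apply Df|].
    replace (RtoC (1 - 2 * s)) with (1 + 2 * RtoC rho * RtoC x)%C; [apply cderiv_quadratic|].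
    rewrite <- !RtoC_mult, <- RtoC_plus. f_equal. rewrite Rmult_assoc, Rx. ring. }
  specialize (Hw _ Dx). specialize (Bw _ Dx). unfold zfpf in Hw.
  destruct (Req_EM_T (Cmod (RtoC x)) 0) as [E|_].
  { apply Cmod_eq_0, RtoC_inj in E. contradiction. }
  rewrite Ef in Hw.
  replace (RtoC x * RtoC (1 - 2 * s) / (RtoC x + RtoC rho * (RtoC x * RtoC x)))%C
    with (RtoC ((1 - 2 * s) / (1 - s))) in Hw.
  2:{ assert (Ed : x + rho * (x * x) = x * (1 - s))
        by (rewrite <- Rmult_assoc, Rx; ring).
      rewrite <- !RtoC_mult, <- RtoC_plus, Ed, <- RtoC_div.
      - f_equal. field. split; [lra|exact Nx].
      - apply Rmult_integral_contrapositive_currified; [exact Nx|lra]. }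
  assert (Q : (1 - 2 * s) / (1 - s) < 1 / 2) by (apply Rlt_div_l; lra).
  set (q := (1 - 2 * s) / (1 - s)) in *.
  unfold unit_disk, disk in Bw. apply Cmod_lt_sqr in Bw; [|lra].
  assert (E : (RtoC (2 * q) = 1 + (1 + w (RtoC x)) * (1 + w (RtoC x)))%C).
  { rewrite RtoC_mult, Hw. unfold phi_car. field. }
  destruct (w (RtoC x)) as [u v]. simpl in Bw.
  assert (E1 := f_equal fst E). assert (E2 := f_equal snd E). simpl in E1, E2.
  assert (V : v * (1 + u) = 0) by lra.
  (* For v = 0 the real part gives 2 q = 1 + (1 + u)^2 >= 1, against q < 1/2; u = -1 is excluded by
     |w| < 1. *)
  apply Rmult_integral in V. destruct V as [V|V]; [subst v; nra|].
  assert (u = -1) by lra. subst u. nra.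
Qed.

Theorem theorem3p4 :
  (* positive part *)
  (forall (f : C -> C) (a : nat -> C),
     taylor_coeffs f a -> a 0%nat = 0%C -> a 1%nat = 1%C -> S_car f ->
     starlike_in (partial2 a) (1/2) /\
     convex_in (partial2 a) (1/4) /\
     (forall rho : R, 0 < rho <= 1/3 ->
        S_car (fun z => (partial2 a (RtoC rho * z) / RtoC rho)%C))) /\
  (* sharpness of 1/2 *)
  (forall r : R, 1/2 < r ->
     exists (f : C -> C) (a : nat -> C),
       taylor_coeffs f a /\ a 0%nat = 0%C /\ a 1%nat = 1%C /\ S_car f /\
       ~ starlike_in (partial2 a) r) /\
  (* sharpness of 1/4 *)
  (forall r : R, 1/4 < r ->
     exists (f : C -> C) (a : nat -> C),
       taylor_coeffs f a /\ a 0%nat = 0%C /\ a 1%nat = 1%C /\ S_car f /\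
       ~ convex_in (partial2 a) r) /\
  (* sharpness of 1/3 *)
  (forall rho : R, 1/3 < rho ->
     exists (f : C -> C) (a : nat -> C),
       taylor_coeffs f a /\ a 0%nat = 0%C /\ a 1%nat = 1%C /\ S_car f /\
       ~ S_car (fun z => (partial2 a (RtoC rho * z) / RtoC rho)%C)).
Proof.
  split; [|split; [|split]].
  - intros f a Hf H0 H1 HS.
    assert (Ha := S_car_coeff2 f a Hf H0 H1 HS).
    split; [now apply quadratic_starlike|]. split; [now apply quadratic_convex|].
    intros rho Hrho. now apply partial2_rescale_S_car.
  - intros r Hr. destruct extremal_function as [f [a [Hf [H0 [H1 [HS H2]]]]]].
    exists f, a. repeat (split; [assumption|]).
    intros [Inj _]. now apply (not_injective_beyond_half a r).
  - intros r Hr. destruct extremal_function as [f [a [Hf [H0 [H1 [HS H2]]]]]].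
    exists f, a. repeat (split; [assumption|]). now apply not_convex_beyond_quarter.
  - intros rho Hrho. destruct extremal_function as [f [a [Hf [H0 [H1 [HS H2]]]]]].
    exists f, a. repeat (split; [assumption|]). now apply not_S_car_beyond_third.
Qed.
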